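(* Let $X$ be a Gromov-hyperbolic metric space with a basepoint $o\in X$, and let $\mu$ be a discrete non-elementary probability measure on the set of isometries of $X$, with escape rate $\ell(\mu)\in[0,\infty]$. Let $g_0,g_1,\dots$ be independent random isometries with distribution $\mu$, and let $Z_n=g_0\cdots g_{n-1}$. Let $r<\ell(\mu)$ be a real number. Then there exists $\kappa>0$ such that, for all $n$, $$\mathbb{P}\big(d(o,Z_n\cdot o)\leq r n\big)\leq e^{-\kappa n}.$$
   Context: Gromov-hyperbolic: a metric space $X$ such that for some $\delta\geq 0$, for all $x,y,z,a\in X$, $(x,z)_a\geq \min((x,y)_a,(y,z)_a)-\delta$, where $(x,z)_y=\frac12(d(x,y)+d(y,z)-d(x,z))$ is the Gromov product. No geodesicity, properness or separability is assumed. Isometries are bijective isometries of $X$. A discrete probability measure is one that is supported on a countable set. $\mu$ is non-elementary if the semigroup generated by the support of $\mu$ contains two loxodromic elements with disjoint sets of fixed points at infinity. The escape rate is $\ell(\mu)=\lim_n \mathbb{E}(d(o,Z_n\cdot o))/n$ if $\mu$ has a moment of order $1$, i.e. $\sum_g \mu(g)d(o,g\cdot o)<\infty$, and $\ell(\mu)=\infty$ otherwise. *)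

(* Defs.v *)
From HB Require Import structures.
From mathcomp Require Import all_boot all_order all_algebra finmap.
From mathcomp Require Import all_classical all_reals all_analysis.

Set Implicit Arguments.
Unset Strict Implicit.
Unset Printing Implicit Defensive.

Import Order.TTheory GRing.Theory Num.Theory.
Import numFieldNormedType.Exports.

Local Open Scope classical_set_scope.
Local Open Scope ring_scope.

Section gromov.
Context {R : realType} {X : metricType R}.
Implicit Types (x y z a o : X) (u v : nat -> X).

Definition gromov_product x z a : R :=
  2^-1 * (mdist x a + mdist a z - mdist x z).

Definition gromov_hyperbolic : Prop :=
  exists2 delta : R, 0 <= delta & forall x y z a,
    Num.min (gromov_product x y a) (gromov_product y z a) - delta
      <= gromov_product x z a.

(* [(u_m, v_n)_o] tends to infinity with [m] and [n]. For [u = v] this says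
   that [u] converges at infinity. *)
Definition converge_together o u v : Prop :=
  forall M : R, exists N : nat, forall m n : nat,
    (N <= m)%N -> (N <= n)%N -> M <= gromov_product (u m) (v n) o.

(* A point at infinity is the class of all sequences equivalent to some given
   sequence converging at infinity. Neither properness nor geodesicity is used.
   The base point is irrelevant, as changing it changes Gromov products by a
   bounded amount. *)
Definition gromov_boundary o : set (set (nat -> X)) :=
  [set xi | exists2 u, converge_together o u u &
    xi = [set v | converge_together o v v /\ converge_together o u v]].

End gromov.
Arguments gromov_hyperbolic {R} X.

Record bij_isometry {R : realType} (X : metricType R) := Isometry {
  isometry_fun :> X -> X ;
  isometry_mdist :
    forall x y, mdist (isometry_fun x) (isometry_fun y) = mdist x y ;
  isometry_bij : bijective isometry_fun
}.

Section isometry_instances.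
Context {R : realType} {X : metricType R}.
Implicit Types f g h : bij_isometry X.

Lemma isometry_eqP f g : isometry_fun f = isometry_fun g -> f = g.
Proof.
case: f g => f df bf [g dg bg] /= fg; rewrite -{}fg in dg bg *.
by rewrite (Prop_irrelevance df dg) (Prop_irrelevance bf bg).
Qed.

Definition isometry_one : bij_isometry X :=
  @Isometry R X idfun (fun _ _ => erefl) (Bijective (frefl _) (frefl _)).

Lemma isometry_mul_mdist f g x y :
  mdist ((f \o g) x) ((f \o g) y) = mdist x y.
Proof. by rewrite /= !isometry_mdist. Qed.

Definition isometry_mul f g : bij_isometry X :=
  Isometry (isometry_mul_mdist f g)
           (bij_comp (isometry_bij f) (isometry_bij g)).

HB.instance Definition _ := gen_eqMixin (bij_isometry X).
HB.instance Definition _ := gen_choiceMixin (bij_isometry X).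
HB.instance Definition _ := isPointed.Build (bij_isometry X) isometry_one.

Lemma isometry_mulA : associative isometry_mul.
Proof. by move=> f g h; exact: isometry_eqP. Qed.

Lemma isometry_mul1 : left_id isometry_one isometry_mul.
Proof. by move=> f; exact: isometry_eqP. Qed.

Lemma isometry_mulr1 : right_id isometry_one isometry_mul.
Proof. by move=> f; exact: isometry_eqP. Qed.

HB.instance Definition _ := isMonoid.Build (bij_isometry X)
  isometry_mulA isometry_mul1 isometry_mulr1.

HB.instance Definition _ := @isMeasurable.Build default_measure_display
  (bij_isometry X) discrete_measurable discrete_measurable0
  discrete_measurableC discrete_measurableU.

End isometry_instances.

Section isometry_defs.
Context {R : realType} {X : metricType R}.
Implicit Types (o : X) (f g : bij_isometry X) (S : set (bij_isometry X)).

(* Positive translation length; by subadditivity the limit always exists. *)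
Definition loxodromic o g : Prop :=
  exists2 tau : R, 0 < tau &
    (fun n => mdist o ((g ^+ n)%g o) / n%:R) @ \oo --> tau.

Definition fixed_at_infinity o g : set (set (nat -> X)) :=
  [set xi | gromov_boundary o xi /\ [set g \o u | u in xi] = xi].

Definition generated_semigroup S : set (bij_isometry X) :=
  smallest [set T | forall f g, T f -> T g -> T (f * g)%g] S.

End isometry_defs.

Section measures_on_isometries.
Context {R : realType} {X : metricType R} (mu : probability (bij_isometry X) R).

Definition discrete_probability : Prop :=
  exists2 C : set (bij_isometry X), countable C & mu (~` C) = 0%E.

(* The support of a discrete measure is its set of atoms. *)
Definition atoms : set (bij_isometry X) := [set h | (0 < mu [set h])%E].

Definition non_elementary (o : X) : Prop :=
  exists f g : bij_isometry X,
    [/\ generated_semigroup atoms f, generated_semigroup atoms g,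
        loxodromic o f, loxodromic o g &
        fixed_at_infinity o f `&` fixed_at_infinity o g = set0].

Definition moment1 (o : X) : \bar R :=
  \esum_(h in [set: bij_isometry X]) (mu [set h] * (mdist o (h o))%:E)%E.

End measures_on_isometries.

Section random_walk.
Context {d : measure_display} {Omega : measurableType d} {R : realType}
        (P : probability Omega R).

Definition mutually_independent {d' : measure_display}
    {T : measurableType d'} (Y : nat -> {RV P >-> T}) : Prop :=
  forall (J : {fset nat}) (A : nat -> set T),
    (forall j, measurable (A j)) ->
    P (\bigcap_(j in [set` J]) (Y j @^-1` A j)) =
    (\prod_(j <- J) P (Y j @^-1` A j))%E.

Context {X : metricType R} (g : nat -> {RV P >-> bij_isometry X}).

Definition walk (n : nat) (w : Omega) : bij_isometry X :=
  (\prod_(i < n) g i w)%g.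

(* Here [mu] is meant to be the common distribution of the [g i]. *)
Definition escape_rate (mu : probability (bij_isometry X) R) (o : X) : \bar R :=
  if (moment1 mu o < +oo)%E then
    limn (fun n => 'E_P[fun w => mdist o (walk n w o)] * (n%:R^-1)%:E)%E
  else +oo%E.

End random_walk.

(* Main.v *)
Require Import Defs.
From HB Require Import structures.
From mathcomp Require Import all_boot all_order all_algebra finmap.
From mathcomp Require Import all_classical all_reals all_analysis.
From mathcomp Require Import measurable_realfun ring lra zify.
Import Order.TTheory GRing.Theory Num.Theory.
Import numFieldNormedType.Exports.
Local Open Scope classical_set_scope.
Local Open Scope ring_scope.
Set Implicit Arguments.
Unset Strict Implicit.
Unset Printing Implicit Defensive.

(** The law is replaced by the finite weighted lists of its first [K] atoms.
Every estimate on them is an upper bound uniform in [K], and such bounds pass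
to the limit because the missing mass tends to 0. In exchange, expectations
are finite sums, which can be exchanged freely.

Gromov products without a subscript are based at [o]; the shadow of [a] at
depth [C] is the set of the [x] with [(a|x) > C].

Non-concentration. After some number of steps, a non-elementary walk charges
arbitrarily many isometries [u_i] such that, for each [a], the shadows of the
[u_i^-1 a] are pairwise disjoint, up to one index ([non_elementary_schottky]).
If the first steps of the walk compose to [u_i], then being in the shadow of
[a] becomes being in the shadow of [u_i^-1 a] for the rest of the walk. An
upper bound for the probability of all shadows can therefore not be nearly
attained at all the [u_i^-1 a], and it improves; iterating this, a late
position of the walk is in a given deep shadow, or in a given ball, with
arbitrarily small probability [eta] ([schottky_unconcentrated]). The inverse
walk has the same property.

Recursion. Let [M_n] be the supremum of the expectation of
[exp (- l (a|b)_{Z_n o})], over all [a], [b] and over the walk and the inverse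
walk; for [a = b = o] this is the Laplace transform of the displacement. Let
[s] be the first letter of [Z_{n+1} = s Z]. Usually [s] is well placed with
respect to [a] and [b], and [Z] does not turn back along
[s]; then the lengths add up ([gp_progress]). The position of [s] is bad with
probability at most [2 eta], and then nothing is gained. If [Z] turns back on
[s], then at some time [j] it passes near [o] in the direction of [s^-1 o].
This costs [eta M_j], and after it a new walk starts. Hence ([laplace_step])

  [M_{n+1} <= (2 eta + c E exp (- l |s|)) M_n
              + c' eta \sum_(j < n) M_j M_{n-1-j}],

a recursion of Catalan type, which forces exponential decay when its
coefficients are small ([catalan_decay], [laplace_decay]). The supremum over
[a] and [b] makes a long jump cost no more than a restart, so that heavy tails
are harmless.

Rate. The recursion is applied to blocks of [M] steps with [l = 1/M]. Then [c]
is close to 1, and the rate of decay per block is close to [- ln] of the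
expectation of [exp (- |Z_M| / M)], where [|Z| = d(o, Z o)]. So it suffices
to find a large [M] such that [|Z_M| > r2 M] with probability close to 1, for
some [r2 > r] ([weak_law]). For this, the recursion with a fixed [l] shows
that a long block is unlikely ever to be undone by what precedes or follows it
([rarely_shadowed]); the lengths of the blocks that are never undone add up
([gain_le_len]), and the truncated lengths of the blocks are independent and
bounded, so that a Chernoff bound applies. The constant in front of the
exponential is finally removed by
[P (|Z_n| <= r n) ^ j <= P (|Z_{nj}| <= r n j)]. *)

(** * Inverses of isometries *)
Section Inverse.
Context {R : realType} {X : metricType R}.
Local Notation G := (bij_isometry X).
Implicit Types (s t : G) (x y : X).

(** Bijectivity is a mere proposition, so preimages are picked by choice. *)
Definition isometry_inv_fun s : X -> X := fun y => xget y [set x | s x = y].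

Lemma isometry_invKV s : cancel (isometry_inv_fun s) s.
Proof.
move=> y; rewrite /isometry_inv_fun; case: xgetP => [x -> //|/= no].
by have [t _ tK] := isometry_bij s; case: (no (t y)) => /=; rewrite tK.
Qed.

Lemma isometry_invK s : cancel s (isometry_inv_fun s).
Proof.
move=> x; apply: (bij_inj (isometry_bij s)).
by rewrite isometry_invKV.
Qed.

Lemma isometry_inv_mdist s x y :
  mdist (isometry_inv_fun s x) (isometry_inv_fun s y) = mdist x y.
Proof. by rewrite -(isometry_mdist s) !isometry_invKV. Qed.

Definition isometry_inv s : G := @Isometry R X (isometry_inv_fun s)
  (isometry_inv_mdist s) (Bijective (isometry_invKV s) (isometry_invK s)).

Arguments isometry_fun : simpl never.

Lemma isom_mulE s t x : (s * t)%g x = s (t x). Proof. by []. Qed.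
Lemma isom_oneE x : (1%g : G) x = x. Proof. by []. Qed.

Lemma isom_invK s x : isometry_inv s (s x) = x.
Proof. exact: isometry_invK. Qed.

Lemma isom_invKV s x : s (isometry_inv s x) = x.
Proof. exact: isometry_invKV. Qed.

Lemma isom_ext s t : (forall x, s x = t x) -> s = t.
Proof. by move=> st; apply: isometry_eqP; apply/funext. Qed.

Lemma isometry_invI : involutive isometry_inv.
Proof.
by move=> s; apply: isom_ext => x; rewrite -{1}(isom_invK s x) isom_invK.
Qed.

Lemma isometry_invM s t :
  isometry_inv (s * t)%g = (isometry_inv t * isometry_inv s)%g.
Proof.
apply: isom_ext => x; apply: (bij_inj (isometry_bij (s * t)%g)).
by rewrite isom_invKV !isom_mulE !isom_invKV.
Qed.

Lemma isometry_inv1 : isometry_inv (1%g : G) = 1%g.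
Proof. by apply: isom_ext => x; rewrite -{1}(isom_oneE x) isom_invK. Qed.

Lemma isometry_inv_mul s : (isometry_inv s * s)%g = 1%g.
Proof. by apply: isom_ext => x; rewrite isom_mulE isom_invK. Qed.

End Inverse.
Arguments isometry_fun : simpl never.

(** * Gromov products *)
Section Gromov.
Context {R : realType} {X : metricType R} (o : X).
Local Notation G := (bij_isometry X).
Local Notation gp := gromov_product.
Local Notation inv := isometry_inv.
Implicit Types (s t : G) (x y z a b : X).

Definition len s := mdist o (s o).

Lemma len_ge0 s : 0 <= len s. Proof. exact: mdist_ge0. Qed.

Lemma len1 : len 1%g = 0. Proof. by rewrite /len mdistxx. Qed.

Lemma len_inv s : len (inv s) = len s.
Proof. by rewrite /len -(isometry_mdist s) isom_invKV metric_sym. Qed.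

Lemma lenM_le s t : len (s * t)%g <= len s + len t.
Proof.
by rewrite /len isom_mulE -(isometry_mdist s o (t o)); exact: metric_triangle.
Qed.

Lemma gpC x y a : gp x y a = gp y x a.
Proof.
rewrite /gp (metric_sym x a) (metric_sym a y) (metric_sym x y); lra.
Qed.

Lemma gp_isom s x y a : gp (s x) (s y) (s a) = gp x y a.
Proof. by rewrite /gp !isometry_mdist. Qed.

Lemma gp_shift s x y : gp x (s y) o = gp (inv s x) y (inv s o).
Proof. by rewrite -[RHS](gp_isom s) !isom_invKV. Qed.

Lemma gp_ge0 x y a : 0 <= gp x y a.
Proof. by rewrite /gp; have := metric_triangle x a y; lra. Qed.

Lemma gp_le_dist x y a : gp x y a <= mdist a x.
Proof.
rewrite /gp; have := metric_triangle a x y.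
by rewrite (metric_sym x a); lra.
Qed.

Lemma gpxx x a : gp x x a = mdist a x.
Proof. by rewrite /gp mdistxx (metric_sym x a); lra. Qed.

Lemma gp_base x a : gp a x a = 0.
Proof. by rewrite /gp mdistxx; lra. Qed.

Lemma gp_lip_base x y a b : gp x y a <= gp x y b + mdist a b.
Proof.
rewrite /gp; have := metric_triangle x b a; have := metric_triangle a b y.
by rewrite (metric_sym b a); lra.
Qed.

Lemma gp_lip x y y' a : gp x y a <= gp x y' a + mdist y y'.
Proof.
rewrite /gp; have := metric_triangle a y' y; have := metric_triangle x y y'.
by rewrite (metric_sym y' y); lra.
Qed.

Lemma dist_inv s x y : mdist x (inv s y) = mdist (s x) y.
Proof. by rewrite -(isometry_mdist s) isom_invKV. Qed.

(** The action of [s] exchanges the two ends of the segment from [inv s o] to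
[o]: the image of [x] follows [s o] for exactly the part of that segment that
[x] does not follow. *)
Lemma gp_flip s x : gp (s x) (s o) o = len s - gp x (inv s o) o.
Proof.
by rewrite /gp /len !dist_inv isometry_mdist (metric_sym (s o) o); lra.
Qed.

Lemma dist_isom s x : mdist o (s x) = len s + mdist o x - 2 * gp (inv s o) x o.
Proof.
rewrite /gp /len ![mdist (inv s o) _]metric_sym !dist_inv.
by rewrite (metric_sym (s o) o) (metric_sym (s x) o); lra.
Qed.

Section Hyperbolic.
Variable delta : R.
Hypothesis delta_ge0 : 0 <= delta.
Hypothesis hyp : forall x y z a,
  Num.min (gp x y a) (gp y z a) - delta <= gp x z a.

(** The form in which hyperbolicity is mostly used: two points that follow each
other for long have nearly the same Gromov products with a third. *)
Lemma hyp_le x y z a c :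
  gp x z a <= c -> c + delta < gp y z a -> gp x y a <= c + delta.
Proof.
by have := hyp x y z a; rewrite /Num.min; case: ifP => _; lra.
Qed.

(** As [x] stays away from [inv s o], the point [s x] follows [s o], which [a]
and [b] leave early. So the way from [a] or [b] to [s x] passes near [o], and
then along the whole of [s]. *)
Lemma gp_progress s x a b C : 0 <= C ->
  gp a (s o) o <= C -> gp b (s o) o <= C -> gp x (inv s o) o <= C ->
  2 * C + delta < len s ->
  len s + mdist o x - 4 * C - 2 * delta <= gp a b (s x).
Proof.
move=> C0 aC bC xC sL.
have sx : C + delta < gp (s x) (s o) o by rewrite gp_flip; lra.
have ax := hyp_le aC sx; have bx := hyp_le bC sx.
have := dist_isom s x; rewrite gpC in xC.
move: ax bx; rewrite {1 2 4}/gp; have := metric_triangle a o b.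
rewrite (metric_sym (s x) b) (metric_sym o b); lra.
Qed.

End Hyperbolic.
End Gromov.

(** * Finite laws and words *)
Lemma bernoulli_le (R : realDomainType) (x : R) n :
  -1 <= x -> 1 + n%:R * x <= (1 + x) ^+ n.
Proof.
move=> x1; elim: n => [|n IH]; first by rewrite mul0r addr0 expr0.
have xx : 0 <= 1 + x by lra.
rewrite exprS -natr1; apply: le_trans (ler_wpM2l xx IH).
have : 0 <= n%:R * (x * x) by rewrite mulr_ge0 // -expr2 sqr_ge0.
by lra.
Qed.

Section Laws.
Context {R : realType}.

Definition ev {T : Type} (th : seq (R * T)) (f : T -> R) : R :=
  \sum_(x <- th) x.1 * f x.2.

(** Mass may be missing: the truncations of a countable law have total mass less
than 1, and upper bounds do not notice. *)
Definition sublaw {T : Type} (th : seq (R * T)) : Prop :=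
  all (fun x => 0 <= x.1) th /\ ev th (fun=> 1) <= 1.

Section Basic.
Context {T U : Type}.
Implicit Types (th : seq (R * T)) (f g : T -> R).

Lemma eq_ev th f g : f =1 g -> ev th f = ev th g.
Proof. by move=> fg; apply: eq_bigr => x _; rewrite fg. Qed.

Lemma ev_le th f g : sublaw th -> (forall x, f x <= g x) -> ev th f <= ev th g.
Proof.
move=> [th0 _] fg; rewrite /ev; elim: th th0 => [|x th IH] /=.
  by rewrite !big_nil.
by case/andP=> x0 th0; rewrite !big_cons lerD ?IH// ler_wpM2l.
Qed.

Lemma evD th f g : ev th (fun x => f x + g x) = ev th f + ev th g.
Proof. by rewrite /ev -big_split; apply: eq_bigr => x _; rewrite mulrDr. Qed.

Lemma evZ th f c : ev th (fun x => c * f x) = c * ev th f.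
Proof. by rewrite /ev mulr_sumr; apply: eq_bigr => x _; rewrite mulrCA. Qed.

Lemma evZr th f c : ev th (fun x => f x * c) = ev th f * c.
Proof. by rewrite mulrC -evZ; apply: eq_ev => x; rewrite mulrC. Qed.

Lemma evB th f g : ev th (fun x => f x - g x) = ev th f - ev th g.
Proof. by rewrite /ev -sumrB; apply: eq_bigr => x _; rewrite mulrBr. Qed.

Lemma ev_sum th (I : Type) (r : seq I) (P : pred I) (F : I -> T -> R) :
  ev th (fun x => \sum_(i <- r | P i) F i x) = \sum_(i <- r | P i) ev th (F i).
Proof.
by rewrite /ev exchange_big; apply: eq_bigr => x _; rewrite mulr_sumr.
Qed.

Lemma ev_ge0 th f : sublaw th -> (forall x, 0 <= f x) -> 0 <= ev th f.
Proof.
move=> Hth f0; have <- : ev th (fun=> 0) = 0.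
  by rewrite /ev big1 // => x _; rewrite mulr0.
exact: ev_le.
Qed.

Lemma ev_cst th c : ev th (fun=> c) = c * ev th (fun=> 1).
Proof. by rewrite -evZ; apply: eq_ev => x; rewrite mulr1. Qed.

Lemma ev_le_cst th f c : sublaw th -> 0 <= c -> (forall x, f x <= c) ->
  ev th f <= c.
Proof.
move=> Hth c0 fc; apply: (le_trans (ev_le Hth fc)); rewrite ev_cst.
by rewrite ler_piMr //; case: Hth.
Qed.

Lemma ev_swap th (ph : seq (R * U)) (F : T -> U -> R) :
  ev th (fun x => ev ph (fun y => F x y)) =
  ev ph (fun y => ev th (fun x => F x y)).
Proof.
rewrite /ev; under eq_bigr do rewrite mulr_sumr.
rewrite exchange_big; apply: eq_bigr => y _; rewrite mulr_sumr.
by apply: eq_bigr => x _; rewrite mulrCA.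
Qed.

Lemma ev_markov th f c : sublaw th -> 0 < c -> (forall x, 0 <= f x) ->
  ev th (fun x => (c <= f x)%R%:R) <= ev th f / c.
Proof.
move=> Hth c0 f0; rewrite -evZr; apply: ev_le => // x.
case: (leP c (f x)) => [cf|_]; last by rewrite divr_ge0 // ltW.
by rewrite ler_pdivlMr // mul1r.
Qed.

End Basic.

Definition map_law {T U : Type} (h : T -> U) (th : seq (R * T)) : seq (R * U) :=
  [seq (x.1, h x.2) | x <- th].

Lemma ev_map {T U : Type} (h : T -> U) th f :
  ev (map_law h th) f = ev th (fun x => f (h x)).
Proof. by rewrite /ev big_map. Qed.

Lemma sublaw_map {T U : Type} (h : T -> U) th :
  sublaw th -> sublaw (map_law h th).
Proof. by case=> th0 th1; split; rewrite ?ev_map // all_map. Qed.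

Section Words.
Context {T : Type}.
Implicit Types (th : seq (R * T)) (F : seq T -> R).

Fixpoint words th n : seq (R * seq T) :=
  if n is n'.+1
  then [seq (x.1 * y.1, x.2 :: y.2) | x <- th, y <- words th n']
  else [:: (1, [::])].

Lemma ev_words0 th F : ev (words th 0) F = F [::].
Proof. by rewrite /ev big_seq1 mul1r. Qed.

Lemma ev_wordsS th n F :
  ev (words th n.+1) F = ev th (fun s => ev (words th n) (fun w => F (s :: w))).
Proof.
rewrite /ev [words _ _]/= big_allpairs_dep /=; apply: eq_bigr => x _.
by rewrite mulr_sumr; apply: eq_bigr => y _; rewrite mulrA.
Qed.

Lemma sublaw_words th n : sublaw th -> sublaw (words th n).
Proof.
move=> Hth; elim: n => [|n IH].
  by split; rewrite ?ev_words0 //= ler01.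
split; last by rewrite ev_wordsS; apply: ev_le_cst => // s; case: IH.
case: Hth IH => + _ [w0 _] /=; elim: th {w0}(words th n) w0 => //= x th IH ys
  ys0.
case/andP=> x0 th0; rewrite all_cat IH // andbT all_map.
by elim: ys ys0 => //= y ys IHys /andP[y0 /IHys->]; rewrite andbT mulr_ge0.
Qed.
Arguments sublaw_words : clear implicits.

Lemma ev_words_cat th n m F :
  ev (words th (n + m)) F =
  ev (words th n) (fun u => ev (words th m) (fun v => F (u ++ v))).
Proof.
elim: n F => [|n IH] F; first by rewrite ev_words0.
by rewrite addSn !ev_wordsS; apply: eq_ev => s; rewrite IH.
Qed.

Lemma ev_words1 th F : ev (words th 1) F = ev th (fun s => F [:: s]).
Proof. by rewrite ev_wordsS; apply: eq_ev => s; rewrite ev_words0. Qed.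

Lemma ev_words_rcons th n F :
  ev (words th n.+1) F =
  ev (words th n) (fun w => ev th (fun s => F (rcons w s))).
Proof.
rewrite -addn1 ev_words_cat; apply: eq_ev => w; rewrite ev_words1.
by apply: eq_ev => s; rewrite cats1.
Qed.

Lemma ev_words_rev th n F : ev (words th n) (fun w => F (rev w)) = ev
  (words th n) F.
Proof.
elim: n F => [|n IH] F; first by rewrite !ev_words0.
rewrite ev_wordsS ev_words_rcons ev_swap -[RHS]IH; apply: eq_ev => w.
by apply: eq_ev => s; rewrite rev_cons.
Qed.

Lemma ev_words_map th h n F :
  ev (words (map_law h th) n) F = ev (words th n) (fun w => F (map h w)).
Proof.
elim: n F => [|n IH] F; first by rewrite !ev_words0.
by rewrite !ev_wordsS ev_map; apply: eq_ev => s; rewrite IH.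
Qed.

Lemma ev_words_le th n F F' : sublaw th ->
  (forall w, size w = n -> F w <= F' w) ->
  ev (words th n) F <= ev (words th n) F'.
Proof.
move=> Hth; elim: n F F' => [|n IH] F F' FF'; first by rewrite !ev_words0 FF'.
rewrite !ev_wordsS; apply: ev_le => // s; apply: IH => w wn.
by apply: FF'; rewrite /= wn.
Qed.

Lemma ev_words_take th n j F : sublaw th -> (j <= n)%N -> (forall w, 0 <= F w)
  ->
  ev (words th n) (fun w => F (take j w)) <= ev (words th j) F.
Proof.
move=> Hth /subnKC <- F0; rewrite ev_words_cat; apply: ev_words_le => // u uj.
apply: ev_le_cst => [|//|v]; first exact: sublaw_words.
by rewrite take_size_cat.
Qed.

Lemma ev_words_prod th n (f : T -> R) :
  ev (words th n) (fun w => \prod_(s <- w) f s) = ev th f ^+ n.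
Proof.
elim: n => [|n IH]; first by rewrite ev_words0 big_nil.
rewrite ev_wordsS exprS -IH -evZr; apply: eq_ev => s.
by rewrite -evZ; apply: eq_ev => w; rewrite big_cons.
Qed.

End Words.

Section Products.
Context {X : metricType R}.
Local Notation G := (bij_isometry X).
Local Notation inv := isometry_inv.
Implicit Types (th : seq (R * G)) (w u v : seq G).

Definition prodw w : G := foldr (fun s t => (s * t)%g) 1%g w.

Lemma prodw_cat u v : prodw (u ++ v) = (prodw u * prodw v)%g.
Proof.
elim: u => [|s u IH] /=; first by rewrite mul1g.
by rewrite IH mulgA.
Qed.

Lemma prodw_rcons u s : prodw (rcons u s) = (prodw u * s)%g.
Proof. by rewrite -cats1 prodw_cat /= mulg1. Qed.

Lemma prodw_inv_rev w : prodw (map inv (rev w)) = inv (prodw w).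
Proof.
elim: w => [|s w IH] /=; first by rewrite isometry_inv1.
by rewrite rev_cons map_rcons prodw_rcons IH isometry_invM.
Qed.

Definition inv_law th := map_law inv th.

Lemma inv_lawK th : inv_law (inv_law th) = th.
Proof.
rewrite /inv_law /map_law -map_comp map_id_in // => -[c s] _ /=.
by rewrite isometry_invI.
Qed.

(** Independent letters can be read in the reverse order, which is the order of
the letters of the inverse. *)
Lemma ev_inv_words th n (f : G -> R) :
  ev (words (inv_law th) n) (fun w => f (prodw w)) =
  ev (words th n) (fun w => f (inv (prodw w))).
Proof.
rewrite ev_words_map -ev_words_rev; apply: eq_ev => w.
by rewrite prodw_inv_rev.
Qed.

(** Blocks of [n] steps are letters of a coarser walk. *)
Definition pow_law th n : seq (R * G) := map_law prodw (words th n).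

Lemma ev_pow th n f : ev (pow_law th n) f = ev (words th n)
  (fun w => f (prodw w)).
Proof. exact: ev_map. Qed.

Lemma sublaw_pow th n : sublaw th -> sublaw (pow_law th n).
Proof. by move=> Hth; apply/sublaw_map/sublaw_words. Qed.

Lemma ev_powD th n m f : ev (pow_law th (n + m)) f =
  ev (pow_law th n) (fun s => ev (pow_law th m) (fun t => f (s * t)%g)).
Proof.
rewrite !ev_pow ev_words_cat; apply: eq_ev => u; rewrite ev_pow.
by apply: eq_ev => v; rewrite prodw_cat.
Qed.

Lemma ev_pow_words th m n f :
  ev (words (pow_law th m) n) (fun w => f (prodw w)) = ev (pow_law th (m * n))
    f.
Proof.
elim: n f => [|n IH] f.
  by rewrite muln0 ev_pow !ev_words0.
rewrite mulnS ev_powD ev_wordsS; apply: eq_ev => s.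
exact: (IH (fun t => f (s * t)%g)).
Qed.

Lemma inv_pow th n f :
  ev (inv_law (pow_law th n)) f = ev (pow_law (inv_law th) n) f.
Proof. by rewrite ev_map !ev_pow ev_inv_words. Qed.

End Products.
End Laws.

(** * Laplace transforms of Gromov products *)
Section Decay.
Context {R : realType} {X : metricType R} (o : X).
Local Notation G := (bij_isometry X).
Local Notation gp := gromov_product.
Local Notation inv := isometry_inv.
Local Notation len := (len o).
Variable delta : R.
Hypothesis delta_ge0 : 0 <= delta.
Hypothesis hyp : forall x y z a : X,
  Num.min (gp x y a) (gp y z a) - delta <= gp x z a.
Implicit Types (th : seq (R * G)) (s t : G) (a b : X).

(** For [a = b = o] this is the Laplace transform of the displacement. The two
points are free because removing the first letter of a word moves them. *)
Definition laplace th (l : R) n a b : R :=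
  ev (words th n) (fun w => expR (- l * gp a b (prodw w o))).

Lemma laplace_ge0 th l n a b : sublaw th -> 0 <= laplace th l n a b.
Proof.
by move=> Hth; apply: ev_ge0 => [|w]; [exact: sublaw_words|exact: expR_ge0].
Qed.

Lemma laplace_le1 th l n a b : sublaw th -> 0 <= l -> laplace th l n a b <= 1.
Proof.
move=> Hth l0; apply: ev_le_cst => // [|w]; first exact: sublaw_words.
by rewrite -expR0 ler_expR mulNr oppr_le0 mulr_ge0 // gp_ge0.
Qed.

Lemma indic_le_exp (l x c : R) : 0 <= l ->
  (x <= c)%R%:R <= expR (l * c) * expR (- l * x).
Proof.
move=> l0; rewrite -expRD; case: (leP x c) => xc; last by rewrite expR_ge0.
by rewrite -expR0 ler_expR; nra.
Qed.

(** The metrization argument of Frink. The chain is cut at the last point before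
which at most half of its total mass lies. The parts before and after the edge
at that point have at most half of the mass, so that by induction each of the
three pieces is bounded by the total mass, and gluing them costs [K ^+ 2]. The
resulting constant does not depend on the number of points of the chain. *)
Lemma frink (T : Type) (rho : T -> T -> R) (K : R) (x : nat -> T) n i :
  (forall u v, 0 <= rho u v) -> 1 <= K -> K ^+ 2 <= 2 ->
  (forall u v w, rho u w <= K * Num.max (rho u v) (rho v w)) ->
  rho (x i) (x (i + n.+1)%N) <=
    2 * \sum_(i <= t < i + n.+1) rho (x t) (x t.+1).
Proof.
move=> rho0 K1 K2 tri; have [m] := ubnP n; elim: m n i => // m IH n i nm.
set S := \sum_(i <= t < _) _.
pose A k := \sum_(i <= t < i + k) rho (x t) (x t.+1).
have A_ge0 k : 0 <= A k by apply: sumr_ge0.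
have A0 : A 0%N = 0 by rewrite /A addn0 big_geq.
have AS k : A k.+1 = A k + rho (x (i + k)%N) (x (i + k).+1).
  by rewrite /A addnS big_nat_recr //= leq_addr.
have S0 : 0 <= S by exact: A_ge0.
have SE k : (k <= n.+1)%N ->
    S = A k + \sum_(i + k <= t < i + k + (n.+1 - k)) rho (x t) (x t.+1).
  move=> kn; rewrite -addnA subnKC // /S /A.
  by rewrite (big_cat_nat (n := (i + k)%N)) ?leq_addr ?leq_add2l.
have edge_le k : (k <= n)%N -> rho (x (i + k)%N) (x (i + k).+1) <= S.
  move=> kn; rewrite (SE k.+1) // AS.
  have : 0 <= \sum_(i + k.+1 <= t < i + k.+1 + (n.+1 - k.+1)) rho (x t)
    (x t.+1).
    exact: sumr_ge0.
  by have := A_ge0 k; lra.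
have head_le k : (k < n)%N -> A k.+1 <= S / 2 -> rho (x i) (x (i + k.+1)%N) <=
  S.
  move=> kn Ak; apply: le_trans (IH k i _) _; first exact: leq_trans kn _.
  by rewrite -/(A k.+1); lra.
pose P k := (k <= n)%N && (A k <= S / 2).
have P0 : exists k, P k by exists 0%N; rewrite /P A0 leq0n /=; lra.
have Pn k : P k -> (k <= n)%N by case/andP.
case: (ex_maxnP P0 Pn) => k /andP[kn Ak] kmax.
have KS : K * S <= 2 * S by rewrite ler_wpM2r //; nra.
have tail : rho (x (i + k)%N) (x (i + n.+1)%N) <= K * S.
  have [kn'|kn'] := ltnP k n; last first.
    have -> : n = k by apply/eqP; rewrite eqn_leq kn' kn.
    rewrite addnS; apply: (le_trans (edge_le k kn)).
    by rewrite ler_peMl.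
  have : ~~ P k.+1 by apply/negP => /kmax; rewrite ltnn.
  rewrite /P kn' /= -ltNge => Ak1.
  apply: le_trans (tri _ (x (i + k).+1) _) _.
  rewrite ler_wpM2l ?(le_trans ler01) // ge_max edge_le //=.
  have := IH (n - k.+1)%N (i + k.+1)%N _.
  have -> : (i + k.+1 + (n - k.+1).+1 = i + n.+1)%N by lia.
  rewrite -addnS => /(_ _)/le_trans; apply; first by lia.
  have := SE k.+1 kn; have -> : (i + k.+1 + (n.+1 - k.+1) = i + n.+1)%N by lia.
  by lra.
case: k => [|k] in kn Ak kmax tail *; first by rewrite addn0 in tail; lra.
apply: le_trans (tri _ (x (i + k.+1)%N) _) _.
apply: (@le_trans _ _ (K * (K * S))); last by rewrite mulrA -expr2 ler_wpM2r.
rewrite ler_wpM2l ?(le_trans ler01) // ge_max tail andbT.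
by apply: (le_trans (head_le k kn Ak)); rewrite ler_peMl.
Qed.

Section Crossing.
Variables (C C1 l' : R).
Hypothesis C_ge0 : 0 <= C.
Hypothesis l'_gt0 : 0 < l'.
Hypothesis l'_delta : expR (2 * (l' * delta)) <= 2.
Hypothesis C1_large : 4 * expR (- l' * C1) <= expR (- l' * C).

Lemma threshold_le : C <= C1.
Proof.
have : expR (- l' * C1) <= expR (- l' * C).
  by apply: le_trans C1_large; rewrite ler_peMl ?expR_ge0 //; lra.
by rewrite ler_expR !mulNr lerN2 ler_pM2l.
Qed.

Lemma visual_quasimetric (x y z : X) :
  expR (- l' * gp x z o) <= expR (l' * delta) *
    Num.max (expR (- l' * gp x y o)) (expR (- l' * gp y z o)).
Proof.
have := hyp x y z o; case: (leP (gp x y o) (gp y z o)) => _ H.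
  apply: (@le_trans _ _ (expR (l' * delta) * expR (- l' * gp x y o))).
    by rewrite -expRD ler_expR; have := ler_wpM2l (ltW l'_gt0) H; lra.
  by rewrite ler_wpM2l ?expR_ge0 // le_max lexx.
apply: (@le_trans _ _ (expR (l' * delta) * expR (- l' * gp y z o))).
  by rewrite -expRD ler_expR; have := ler_wpM2l (ltW l'_gt0) H; lra.
by rewrite ler_wpM2l ?expR_ge0 // le_max lexx orbT.
Qed.

(** In a tree, a path from [o] enters the shadow of [y] by a step that passes
near [o]. If [delta > 0] it may also creep in by many steps, each of which gains
less than [delta]. But [exp (- l' (x|y))] is a quasi-metric: after the last
position outside of the shadow at depth [C], it is summed along the path
followed by [y], which loses only the constant of [frink]. *)
Lemma crossing_bound (p : nat -> X) y n : p 0%N = o -> C1 < gp (p n) y o ->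
  1 <= 4 * expR (l' * C) * \sum_(j < n) expR (- l' * gp (p j) (p j.+1) o) *
    (C < gp (p j.+1) y o)%R%:R.
Proof.
move=> p0 pn.
have CC1 := threshold_le.
pose P i := (i <= n)%N && (gp (p i) y o <= C).
have P0 : exists i, P i by exists 0%N; rewrite /P p0 gp_base.
clear p0.
have Pn i : P i -> (i <= n)%N by case/andP.
case: (ex_maxnP P0 Pn) => i /andP[i_n pi] imax.
have i_lt : (i < n)%N.
  rewrite ltn_neqAle i_n andbT; apply/eqP => in_; rewrite in_ in pi.
  by have := le_lt_trans (le_trans pi CC1) pn; rewrite ltxx.
have far j : (i <= j < n)%N -> C < gp (p j.+1) y o.
  move=> /andP[ij jn]; rewrite ltNge; apply/negP => H.
  by have := imax j.+1; rewrite /P jn H => /(_ isT); rewrite ltnNge ij.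
pose x (t : nat) := if (t <= n)%N then p t else y.
have := @frink _ (fun u v => expR (- l' * gp u v o)) (expR (l' * delta)) x
  (n - i) i
  (fun _ _ => expR_ge0 _) _ _ visual_quasimetric.
have -> : (i + (n - i).+1 = n.+1)%N by lia.
rewrite -expRM_natl -{1}expR0 ler_expR mulr_ge0 ?(ltW l'_gt0) //.
move=> /(_ isT l'_delta).
rewrite big_nat_recr /=; last exact: ltnW.
rewrite /x i_n leqnn ltnn.
have -> : \sum_(i <= t < n) expR (- l' * gp (if (t <= n)%N then p t else y)
    (if (t < n)%N then p t.+1 else y) o) =
  \sum_(i <= t < n) expR (- l' * gp (p t) (p t.+1) o) *
    (C < gp (p t.+1) y o)%R%:R.
  apply: eq_big_nat => t /andP[it tn]; rewrite tn (ltnW tn) far ?it //.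
  by rewrite mulr1.
set S := \sum_(i <= t < n) _ => H.
have SS : S <= \sum_(j < n) expR (- l' * gp (p j) (p j.+1) o) *
    (C < gp (p j.+1) y o)%R%:R.
  rewrite -(big_mkord xpredT (fun j => expR (- l' * gp (p j) (p j.+1) o) *
    (C < gp (p j.+1) y o)%R%:R)) (big_cat_nat (n := i)) //=.
  by rewrite lerDr sumr_ge0 // => j _; rewrite mulr_ge0 ?expR_ge0.
have pnE : expR (- l' * gp (p n) y o) <= expR (- l' * C1).
  by rewrite ler_expR !mulNr lerN2 ler_pM2l // ltW.
have piE : expR (- l' * C) <= expR (- l' * gp (p i) y o).
  by rewrite ler_expR !mulNr lerN2 ler_pM2l.
have {}H : expR (- l' * C) <= 4 * S.
  by move: H pnE piE C1_large; lra.
rewrite -(ler_pM2l (expR_gt0 (- l' * C))) mulr1.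
rewrite (mulrC 4) !mulrA -expRD mulNr addNr expR0 mul1r.
by rewrite -mulNr; lra.
Qed.

End Crossing.

(* Turning back is measured with a fixed exponent [l'], while the exponent [l]
   of the Laplace transform may be as small as the inverse of a block length. *)
Section Step.
Variables (th : seq (R * G)) (C C1 eta l' l sg : R).
Hypothesis Hth : sublaw th.
Hypothesis C_ge0 : 0 <= C.
Hypothesis l'_gt0 : 0 < l'.
Hypothesis l'_delta : expR (2 * (l' * delta)) <= 2.
Hypothesis C1_large : 4 * expR (- l' * C1) <= expR (- l' * C).
Hypothesis l_ge0 : 0 <= l.
Hypothesis l_le : l <= l'.
Hypothesis good_start : forall a, ev th (fun s => (C < gp a (s o) o)%R%:R) <=
  eta.
Hypothesis good_end : forall a,
  ev th (fun s => (C < gp a (inv s o) o)%R%:R) <= eta.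
Hypothesis letter_laplace : ev th (fun s => expR (- l * len s)) <= sg.
Variables M N : nat -> R.
Hypothesis HM : forall i a b, laplace th l i a b <= M i.
Hypothesis HN : forall i a b, laplace (inv_law th) l i a b <= N i.

Let M_ge0 i : 0 <= M i.
Proof. exact: le_trans (laplace_ge0 l i o o Hth) (HM i o o). Qed.

Let laplace_isom s n a b :
  ev (words th n) (fun w => expR (- l * gp a b (s (prodw w o)))) <= M n.
Proof.
apply: le_trans (HM n (inv s a) (inv s b)); rewrite le_eqVlt; apply/orP; left.
apply/eqP/eq_ev => w; congr (expR (_ * _)).
by rewrite -[RHS](gp_isom s) !isom_invKV.
Qed.

Let eta_ge0 : 0 <= eta.
Proof. by apply: le_trans (good_start o); apply: ev_ge0. Qed.

(** The terms of [crossing_bound] for a walk that undoes the letter [s]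
preceding it. *)
Let turnback s (w : seq G) j : R :=
  expR (- l' * gp (prodw (take j w) o) (prodw (take j.+1 w) o) o) *
  (C < gp (prodw (take j.+1 w) o) (inv s o) o)%R%:R.

Let turnback_ge0 s w j : 0 <= turnback s w j.
Proof. by rewrite mulr_ge0 ?expR_ge0. Qed.

(** Seen from the position at time [j], returning to [o] is a matter of the
inverse walk. *)
Let return_le j t : ev (words th j) (fun u =>
    expR (- l' * gp (prodw u o) (prodw u (t o)) o)) <= N j.
Proof.
apply: le_trans (HN j o (t o)).
rewrite /laplace (ev_inv_words th j (fun z => expR (- l * gp o (t o) (z o)))).
apply: ev_le => [|u]; first exact: sublaw_words.
rewrite -(gp_isom (inv (prodw u))) !isom_invK ler_expR !mulNr lerN2.
by rewrite ler_wpM2r // gp_ge0.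
Qed.

(** The three factors come from independent parts of the word: the first [j]
letters of [w], which return near [o]; the letter [s], which by chance points
where they arrive; and the letters after time [j], which start anew. *)
Let turnback_le a b n j : (j < n)%N ->
  ev th (fun s => ev (words th n) (fun w =>
    turnback s w j * expR (- l * gp a b (s (prodw w o)))))
  <= eta * (N j * M (n - j.+1)%N).
Proof.
move=> jn; set m := (n - j.+1)%N.
apply: (@le_trans _ _ (ev th (fun s => ev (words th j) (fun u => ev th (fun t =>
    expR (- l' * gp (prodw u o) (prodw u (t o)) o) *
    (C < gp (prodw u (t o)) (inv s o) o)%R%:R * M m))))).
  apply: ev_le => // s.
  rewrite -{1}(subnKC jn) addSnnS ev_words_cat.
  apply: ev_words_le => // u uj; rewrite ev_wordsS; apply: ev_le => // t.
  have -> : expR (- l' * gp (prodw u o) (prodw u (t o)) o) *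
    (C < gp (prodw u (t o)) (inv s o) o)%R%:R = turnback s (rcons u t) j.
    rewrite /turnback -cats1 take_size_cat // take_oversize ?size_cat ?uj
      ?addn1//.
    by rewrite prodw_cat /= mulg1 isom_mulE.
  apply: le_trans (ler_wpM2l (turnback_ge0 s (rcons u t) j)
    (laplace_isom (s * prodw (rcons u t))%g m a b)).
  rewrite -evZ; apply: ev_words_le => // v _.
  rewrite -cat_rcons prodw_cat !isom_mulE.
  have tk : take j.+1 (rcons u t ++ v) = rcons u t.
    by rewrite take_size_cat // size_rcons uj.
  have tk' : take j (rcons u t ++ v) = take j (rcons u t).
    by rewrite -[in LHS](minn_idPl (leqnSn j)) take_min tk.
  have tk'' : take j.+1 (rcons u t) = rcons u t.
    by rewrite take_oversize // size_rcons uj.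
  by rewrite /turnback tk tk' tk''.
rewrite ev_swap.
under eq_ev do rewrite ev_swap.
apply: (@le_trans _ _ (ev (words th j) (fun u => ev th (fun t =>
    expR (- l' * gp (prodw u o) (prodw u (t o)) o) * (eta * M m))))).
  apply: ev_words_le => // u uj; apply: ev_le => // t.
  under eq_ev do rewrite -mulrA.
  rewrite evZ ler_wpM2l ?expR_ge0 // evZr ler_wpM2r //.
rewrite ev_swap.
have N0 : 0 <= N j.
  by apply: le_trans (HN j o o); apply/laplace_ge0/sublaw_map.
apply: ev_le_cst => // [|t]; first by rewrite !mulr_ge0.
by rewrite evZr mulrCA ler_wpM2l // ler_wpM2r.
Qed.

(** The four cases are [s] badly placed with respect to [a] or to [b], a
continuation that turns back on [s], bounded by the sum over [j], and lengths
that add up. *)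
Lemma laplace_step n a b :
  laplace th l n.+1 a b <=
  (2 * eta + expR (l * (4 * C1 + 2 * delta)) * sg) * M n +
  4 * expR (l' * C) * eta * \sum_(j < n) N j * M (n - j.+1)%N.
Proof.
pose E s (w : seq G) := expR (- l * gp a b (s (prodw w o))).
pose c := expR (l * (4 * C1 + 2 * delta)).
pose k := 4 * expR (l' * C).
have k_ge0 : 0 <= k by rewrite mulr_ge0 ?expR_ge0.
have CC1 := threshold_le l'_gt0 C1_large.
(* If [s] is short then [c * expR (- l * len s) >= 1] and nothing is to be
   proved. *)
pose third s w := c * expR (- l * len s) *
  (if 2 * C1 + delta < len s then expR (- l * gp o o (prodw w o)) else E s w).
have pointwise s w : size w = n -> E s w <=
    (C < gp a (s o) o)%R%:R * E s w + (C < gp b (s o) o)%R%:R * E s w +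
    third s w + \sum_(j < n) k * (turnback s w j * E s w).
  move=> wn; have E0 : 0 <= E s w by exact: expR_ge0.
  have third0 : 0 <= third s w.
    by rewrite /third !mulr_ge0 ?expR_ge0 //; case: ifP => _; rewrite ?expR_ge0.
  have sum0 : 0 <= \sum_(j < n) k * (turnback s w j * E s w).
    by apply: sumr_ge0 => j _; rewrite !mulr_ge0.
  case: (ltP C (gp a (s o) o)) => [_|aC].
    by rewrite mul1r -!addrA lerDl !addr_ge0 // mulr_ge0.
  case: (ltP C (gp b (s o) o)) => [_|bC].
    by rewrite mul0r add0r mul1r -addrA lerDl addr_ge0.
  rewrite !mul0r !add0r.
  case: (ltP C1 (gp (prodw w o) (inv s o) o)) => [wC|wC].
    have := crossing_bound C_ge0 l'_gt0 l'_delta C1_large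
      (p := fun j => prodw (take j w) o) (y := inv s o) (n := n).
    rewrite take0 -wn take_size => /(_ erefl wC) H.
    have {H} := ler_wpM2r E0 H; rewrite mul1r -[leRHS]mulrA mulr_suml wn.
    move=> H; apply: (le_trans H); rewrite -mulr_sumr -/k [leRHS]addrC.
    by rewrite -[leLHS]addr0 lerD.
  apply: (@le_trans _ _ (third s w)); last by rewrite lerDl.
  rewrite /third /c -expRD; case: ifP => sL.
    rewrite -expRD ler_expR gpxx.
    have := gp_progress hyp (le_trans C_ge0 CC1) (le_trans aC CC1)
      (le_trans bC CC1) wC sL.
    by rewrite metric_sym => /(ler_wpM2l l_ge0); rewrite (metric_sym _ o); lra.
  rewrite ler_peMl // -[leLHS]expR0 ler_expR.
  move/negbT: sL; rewrite -leNgt => sL.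
  have : l * len s <= l * (4 * C1 + 2 * delta) by rewrite ler_wpM2l //;
    move: C_ge0 delta_ge0; lra.
  by lra.
rewrite /laplace ev_wordsS.
apply: (@le_trans _ _ (ev th (fun s => ev (words th n) (fun w =>
    (C < gp a (s o) o)%R%:R * E s w + (C < gp b (s o) o)%R%:R * E s w +
    third s w + \sum_(j < n) k * (turnback s w j * E s w))))).
  by apply: ev_le => // s; apply: ev_words_le => // w wn; exact: pointwise.
under eq_ev do rewrite !evD ev_sum.
rewrite !evD ev_sum; apply: lerD.
  rewrite mulrDl; apply: lerD.
    rewrite -mulrA mulr_natl mulr2n; apply: lerD.
      apply: (@le_trans _ _ (ev th (fun s => (C < gp a (s o) o)%R%:R * M n))).
        by apply: ev_le => // s; rewrite evZ ler_wpM2l // laplace_isom.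
      by rewrite evZr ler_wpM2r.
    apply: (@le_trans _ _ (ev th (fun s => (C < gp b (s o) o)%R%:R * M n))).
      by apply: ev_le => // s; rewrite evZ ler_wpM2l // laplace_isom.
    by rewrite evZr ler_wpM2r.
  apply: (@le_trans _ _ (ev th (fun s => c * expR (- l * len s) * M n))).
    apply: ev_le => // s; rewrite evZ ler_wpM2l ?mulr_ge0 ?expR_ge0 //.
    by case: (2 * C1 + delta < len s); [exact: HM|exact: laplace_isom].
  by rewrite evZr evZ ler_wpM2r // ler_wpM2l ?expR_ge0.
rewrite mulr_sumr; apply: ler_sum => j _.
under eq_ev do rewrite evZ.
rewrite evZ (_ : _ * eta * _ = k * (eta * (N j * M (n - j.+1)%N))).
  by rewrite ler_wpM2l // turnback_le.
by rewrite /k !mulrA.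
Qed.

End Step.

(** The generating function [f] of [M] satisfies [f(T) <= 1 + eps T f(T) + eps'
T^2 f(T)^2]. The same inequality between consecutive partial sums keeps them all
below a [B] that the right-hand side maps below itself. *)
Lemma catalan_decay (M : nat -> R) (eps eps' T B : R) :
  (forall n, 0 <= M n) -> M 0%N <= 1 ->
  (forall n, M n.+1 <= eps * M n + eps' * \sum_(j < n) M j * M (n - j.+1)%N) ->
  0 <= eps -> 0 <= eps' -> 0 <= T -> 0 <= B ->
  1 + eps * T * B + eps' * T ^+ 2 * B ^+ 2 <= B ->
  forall n, M n * T ^+ n <= B.
Proof.
move=> M0 M01 Mrec e0 e'0 T0 B0 HB.
pose x n := M n * T ^+ n; pose S N := \sum_(n < N) x n.
have x0 n : 0 <= x n by rewrite mulr_ge0 ?exprn_ge0.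
have S0 N : 0 <= S N by apply: sumr_ge0.
have conv N : \sum_(n < N) \sum_(j < n) x j * x (n - j.+1)%N <= S N ^+ 2.
  rewrite expr2 {1}/S mulr_suml.
  under eq_bigr => n _.
    rewrite -(big_mkord xpredT (fun j => x j * x (n - j.+1)%N)).
    rewrite (big_nat_widen _ _ N) ?(ltnW (ltn_ord n)) //=.
    over.
  rewrite /= (eq_bigr (fun n : 'I_N =>
    \sum_(j < N | (j < n)%N) x j * x (n - j.+1)%N)); last first.
    by move=> n _; rewrite big_mkord.
  rewrite (exchange_big_dep xpredT) //=; apply: ler_sum => j _.
  rewrite -mulr_sumr ler_wpM2l // /S.
  rewrite -(big_mkord xpredT x) -(big_mkord (fun n => j < n)%N
    (fun n => x (n - j.+1)%N)).
  rewrite (big_cat_nat (n := j.+1)) //=.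
  rewrite big_nat_cond big1 ?add0r; last first.
    by move=> i /andP[/andP[_ ij] ji]; move: ij; rewrite ltnS leqNgt ji.
  rewrite big_nat_cond (eq_bigl (fun i => (j.+1 <= i < N)%N)); last first.
    by move=> i; case: ltngtP; rewrite ?andbF ?andbT.
  rewrite -big_nat -{1}[j.+1]add0n big_addn.
  under eq_bigr do rewrite addnK.
  rewrite [leRHS](big_cat_nat (n := (N - j.+1)%N)) ?leq_subr //=.
  by rewrite lerDl sumr_ge0.
have SB N : S N <= B.
  elim: N => [|N IH].
    by rewrite /S big_ord0.
  rewrite /S big_ord_recl /=; apply: le_trans HB.
  rewrite -addrA lerD //; first by rewrite /x expr0 mulr1.
  apply: (@le_trans _ _ (eps * T * S N + eps' * T ^+ 2 * S N ^+ 2)); last first.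
    by rewrite lerD // ler_wpM2l ?mulr_ge0 ?exprn_ge0 // lerXn2r ?nnegrE //
      (le_trans _ IH).
  apply: (@le_trans _ _ (eps * T * S N + eps' * T ^+ 2 *
     \sum_(n < N) \sum_(j < n) x j * x (n - j.+1)%N)); last first.
    by rewrite lerD2l ler_wpM2l ?mulr_ge0 ?exprn_ge0.
  rewrite /S 2!mulr_sumr -big_split /=; apply: ler_sum => n _.
  apply: (le_trans (ler_wpM2r (exprn_ge0 n.+1 T0) (Mrec n))).
  rewrite mulrDl lerD //; first by rewrite /x exprS !mulrA (mulrAC eps).
  rewrite -mulrA -mulrA ler_wpM2l // mulr_suml mulr_sumr.
  apply: ler_sum => j _; rewrite /x le_eqVlt; apply/orP; left; apply/eqP.
  have -> : T ^+ n.+1 = T ^+ 2 * (T ^+ j * T ^+ (n - j.+1)).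
    by rewrite -!exprD; congr (_ ^+ _); have := ltn_ord j; lia.
  by rewrite /=; ring.
move=> n; apply: le_trans (SB n.+1); rewrite /S big_ord_recr /= lerDr.
by apply: sumr_ge0.
Qed.

Definition spread th (C eta : R) : Prop :=
  (forall a, ev th (fun s => (C < gp a (s o) o)%R%:R) <= eta) /\
  (forall a, ev th (fun s => (C < gp a (inv s o) o)%R%:R) <= eta).

Lemma spread_inv th C eta : spread th C eta -> spread (inv_law th) C eta.
Proof.
case=> H1 H2; split=> a; rewrite ev_map //.
by under eq_ev do rewrite isometry_invI.
Qed.

Lemma spread_ge0 th C eta : sublaw th -> spread th C eta -> 0 <= eta.
Proof. by move=> Hth [/(_ o) H _]; apply: le_trans H; apply: ev_ge0. Qed.

(** The recursion for a law involves the inverse law and conversely, and it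
moves the endpoints; it closes on the supremum over both laws and all endpoints.
*)
Lemma laplace_decay th (C C1 eta l' l sg T B : R) :
  sublaw th -> 0 <= C -> 0 < l' -> expR (2 * (l' * delta)) <= 2 ->
  4 * expR (- l' * C1) <= expR (- l' * C) ->
  0 <= l -> l <= l' -> spread th C eta ->
  ev th (fun s => expR (- l * len s)) <= sg -> 0 <= T -> 0 <= B ->
  1 + (2 * eta + expR (l * (4 * C1 + 2 * delta)) * sg) * T * B +
    (4 * expR (l' * C) * eta) * T ^+ 2 * B ^+ 2 <= B ->
  forall n a b, laplace th l n a b * T ^+ n <= B.
Proof.
move=> Hth C0 l'0 l'd C1C l0 ll' sp Hsg T0 B0 HB n a b.
have Hth' : sublaw (inv_law th) by exact: sublaw_map.
have Hsg' : ev (inv_law th) (fun s => expR (- l * len s)) <= sg.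
  by rewrite ev_map; under eq_ev do rewrite len_inv.
have eta0 := spread_ge0 Hth sp.
have sg0 : 0 <= sg by apply: le_trans Hsg; apply: ev_ge0 => // s;
  exact: expR_ge0.
pose V i : set R := [set v | exists a b, v = laplace th l i a b \/
  v = laplace (inv_law th) l i a b].
pose M i := sup (V i).
have ubV i : has_ubound (V i).
  by exists 1 => _ [a' [b' [->|->]]]; exact: laplace_le1.
have MV i a' b' : laplace th l i a' b' <= M i.
  by apply: ub_le_sup => //; exists a', b'; left.
have MV' i a' b' : laplace (inv_law th) l i a' b' <= M i.
  by apply: ub_le_sup => //; exists a', b'; right.
have M0 i : 0 <= M i by exact: le_trans (laplace_ge0 l i o o Hth) (MV i o o).
have V0 i : V i !=set0 by exists (laplace th l i o o), o, o; left.
apply: (@le_trans _ _ (M n * T ^+ n)).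
  by rewrite ler_wpM2r ?exprn_ge0.
apply: (catalan_decay M0 _ _ _ _ T0 B0 HB).
- by apply: ge_sup => // _ [a' [b' [->|->]]]; exact: laplace_le1.
- move=> m; apply: ge_sup => // _ [a' [b' [->|->]]].
    by case: sp => H1 H2; exact: laplace_step.
  have [H1 H2] := spread_inv sp.
  by apply: laplace_step => // i a'' b''; rewrite inv_lawK.
- by rewrite addr_ge0 ?mulr_ge0 ?expR_ge0.
- by rewrite !mulr_ge0 ?expR_ge0.
Qed.

End Decay.

(** * Non-concentration *)
Section Concentration.
Context {R : realType} {X : metricType R} (o : X).
Local Notation G := (bij_isometry X).
Local Notation gp := gromov_product.
Local Notation inv := isometry_inv.
Local Notation len := (len o).
Implicit Types (s t u : G) (a b y : X).

(** What will be known of the truncations of a probability measure to its first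
[K] atoms. *)
Definition exhausting (th : nat -> seq (R * G)) : Prop :=
  [/\ forall K, sublaw (th K),
      forall K K' (f : G -> R), (K <= K')%N -> (forall s, 0 <= f s) ->
        ev (th K) f <= ev (th K') f &
      forall e : R, 0 < e -> exists K, 1 - e <= ev (th K) (fun=> 1)].

Lemma exhausting_inv th : exhausting th -> exhausting (inv_law \o th).
Proof.
case=> H1 H2 H3; split=> [K|K K' f KK' f0|e e0]; first exact: sublaw_map.
- by rewrite !ev_map; apply: H2.
- by have [K HK] := H3 e e0; exists K; rewrite ev_map.
Qed.

Section Family.
Variable th : nat -> seq (R * G).
Hypothesis Hth : exhausting th.

Let Hsub K : sublaw (th K). Proof. by case: Hth. Qed.

Lemma ev_words_mono K K' n (F : seq G -> R) : (K <= K')%N ->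
  (forall w, 0 <= F w) -> ev (words (th K) n) F <= ev (words (th K') n) F.
Proof.
case: Hth => _ mono _ KK'; elim: n F => [|n IH] F F0;
  first by rewrite !ev_words0.
rewrite !ev_wordsS.
apply: (@le_trans _ _ (ev (th K) (fun s => ev (words (th K') n)
  (fun w => F (s :: w))))).
  by apply: ev_le => // s; exact: IH.
by apply: mono => // s; apply: ev_ge0 => //; exact: sublaw_words.
Qed.

Lemma ev_pow_mono K K' n (f : G -> R) : (K <= K')%N ->
  (forall s, 0 <= f s) -> ev (pow_law (th K) n) f <= ev (pow_law (th K') n) f.
Proof. by move=> KK' f0; rewrite !ev_pow; exact: ev_words_mono. Qed.

Lemma words_mass n (e : R) : 0 < e ->
  exists K, 1 - e <= ev (words (th K) n) (fun=> 1).
Proof.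
case: Hth => _ _ mass e0.
have [|K HK] := mass (e / n.+1%:R); first by rewrite divr_gt0.
exists K; set x := e / n.+1%:R in HK.
have [x1|x1] := leP x 1; last first.
  have xe : x <= e by rewrite ler_pdivrMr // ler_peMr ?ler1n // ltW.
  apply: (@le_trans _ _ 0); first by lra.
  by apply: ev_ge0 => //; exact: sublaw_words.
have -> : ev (words (th K) n) (fun=> 1) = ev (th K) (fun=> 1) ^+ n.
  by rewrite -ev_words_prod; apply: eq_ev => w; rewrite big1.
apply: (@le_trans _ _ ((1 - x) ^+ n)); last by rewrite lerXn2r ?nnegrE //; lra.
apply: le_trans (bernoulli_le n _); last by lra.
rewrite mulrN lerD2l lerN2 /x mulrCA ler_piMr ?(ltW e0) // ler_pdivrMr // mul1r
  ler_nat.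
by [].
Qed.

Lemma law_bounded (l : seq (R * G)) (h : G -> R) : exists2 B, 0 <= B &
  forall f g : G -> R, (forall s, h s <= B -> f s = g s) -> ev l f = ev l g.
Proof.
elim: l => [|x l [B B0 HB]]; first by exists 0 => // f g _;
  rewrite /ev !big_nil.
exists (Num.max (h x.2) B) => [|f g fg]; first by rewrite le_max B0 orbT.
rewrite /ev !big_cons fg ?le_max ?lexx //; congr (_ + _).
by apply: HB => s sB; rewrite fg // le_max sB orbT.
Qed.

(** Some truncation has almost all the mass and finitely many values of [h];
larger truncations add little to it. *)
Lemma tight n (h : G -> R) (e : R) : 0 < e ->
  exists2 B, 0 <= B & forall K, ev (pow_law (th K) n) (fun s => (B < h s)%R%:R)
    <= e.
Proof.
move=> /(words_mass n)[K1 HK1].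
have [B B0 HB] := law_bounded (pow_law (th K1) n) h.
exists B => // K.
have KK : (K <= maxn K K1)%N by exact: leq_maxl.
apply: (le_trans (ev_pow_mono n KK _)) => //.
have -> : ev (pow_law (th (maxn K K1)) n) (fun s => (B < h s)%R%:R) =
   ev (pow_law (th (maxn K K1)) n) (fun s => 1 - (h s <= B)%R%:R).
  by apply: eq_ev => s; case: (leP (h s) B); rewrite ?subrr ?subr0.
rewrite evB.
have : ev (pow_law (th (maxn K K1)) n) (fun=> 1) <= 1.
  by case: (sublaw_pow n (Hsub (maxn K K1))).
have := ev_pow_mono (f := fun s => (h s <= B)%R%:R) n (leq_maxr K K1)
  (fun _ => ler0n _ _).
rewrite (HB _ (fun=> 1)); last by move=> s ->.
by rewrite ev_pow; lra.
Qed.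

(** A lower bound for the mass of [u] after [n] steps that is uniform in the
truncation. Tested against functions, it passes to products of isometries by
Fubini. *)
Definition charged n u : Prop := exists2 al : R, 0 < al &
  exists K0, forall K (f : G -> R), (K0 <= K)%N -> (forall s, 0 <= f s) ->
    al * f u <= ev (pow_law (th K) n) f.

(** Balls are included so that the estimate on shadows also shows that the walk
leaves bounded sets. *)
Definition shadow (C L : R) a y : bool := (C < gp a y o) || (mdist a y <= L).

(** The index [i0] has to be excluded because [a] may be close to one of the [us
i o], in which case [inv (us i) a] is close to [o]. *)
Definition schottky : Prop := forall k (L : R), 0 <= L -> exists n (D : R)
  (us : 'I_k.+1 -> G),
  (forall i, charged n (us i)) /\
  forall a, exists i0, forall C y i j, D <= C -> i != i0 -> j != i0 ->
    shadow C L (inv (us i) a) y -> shadow C L (inv (us j) a) y -> i = j.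

Definition unconcentrated (L q : R) : Prop := exists C n0, forall K n a,
  (n0 <= n)%N -> ev (pow_law (th K) n) (fun z => (shadow C L a (z o))%:R) <= q.

Lemma shadow_mono C C' L a y : C <= C' -> shadow C' L a y -> shadow C L a y.
Proof.
by move=> CC' /orP[H|H]; apply/orP; [left; exact: le_lt_trans H|right].
Qed.

Lemma shadow_shift C L B u a y : len u <= B ->
  shadow (C + B) L a (u y) -> shadow C L (inv u a) y.
Proof.
move=> uB /orP[H|H]; apply/orP; [left|right].
  have := gp_lip_base (inv u a) y (inv u o) o.
  rewrite -gp_shift metric_sym; have := len_inv o u.
  by rewrite {1}/len; lra.
by rewrite -(isometry_mdist u) isom_invKV.
Qed.

Lemma charged_uniform k n (us : 'I_k.+1 -> G) : (forall i, charged n (us i)) ->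
  exists2 al : R, 0 < al & exists K0, forall K (f : G -> R), (K0 <= K)%N ->
    (forall s, 0 <= f s) ->
    al * (\sum_i f (us i)) <= ev (pow_law (th K) n) f.
Proof.
move=> ch; pose P i (x : R * nat) := 0 < x.1 /\
  forall K (f : G -> R), (x.2 <= K)%N -> (forall s, 0 <= f s) ->
    x.1 * f (us i) <= ev (pow_law (th K) n) f.
have /choice[x Hx] : forall i, exists x, P i x.
  by move=> i; have [al al0 [K0 HK]] := ch i; exists (al, K0).
pose m := \big[Num.min/1]_i (x i).1.
have m0 : 0 < m.
  by rewrite /m; elim/big_ind: _ => // [a b a0 b0|i _];
    [rewrite lt_min a0 b0|case: (Hx i)].
have m_le i : m <= (x i).1 by exact: bigmin_le.
exists (m / k.+1%:R); first by rewrite divr_gt0.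
exists (\max_i (x i).2) => K f HK f0.
rewrite mulrAC ler_pdivrMr // mulr_sumr.
rewrite mulr_natr -[X in _ *+ X]card_ord -sumr_const.
apply: ler_sum => i _; have [_ H] := Hx i; apply: le_trans (H K f _ f0).
  by rewrite ler_wpM2r.
exact: leq_trans (leq_bigmax i) HK.
Qed.

(** Conditionally on the first steps, the probability is at most [q]. But if
they compose to some [us i], it is that of a set depending on [i], and these
sets are disjoint up to one index: on average over the [us i], the probability
is about [1 / k] only. The average has a definite weight [al], as the [us i] are
charged. *)
Lemma unconcentrated_improve k L : schottky -> 0 <= L -> exists2 al : R,
  0 < al &
  forall q e, 0 <= q -> 0 < e -> unconcentrated L q ->
    unconcentrated L (q + e - al * (k%:R * q - 1)).
Proof.
move=> /(_ k L) /[apply] -[n [D [us [ch sep]]]].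
have [al al0 [K0 HK0]] := charged_uniform ch.
exists al => // q e q0 e0 [C [n0 HC]].
have [B B0 HB] := tight n len e0.
pose C' := Num.max C D.
exists (C' + B), (n + n0)%N => K m a nm.
have -> : (m = n + (m - n))%N by rewrite subnKC // (leq_trans _ nm) // leq_addr.
have {nm}nm : (n0 <= m - n)%N by rewrite leq_subRL // (leq_trans _ nm) //
  leq_addr.
set m' := (m - n)%N in nm *.
apply: (le_trans (ev_pow_mono _ (leq_maxl K K0) _)) => //.
set K' := maxn K K0; rewrite ev_powD.
pose phi u := ev (pow_law (th K') m') (fun z =>
  (shadow C' L (inv u a) (z o))%:R).
have phi_q u : phi u <= q.
  apply: le_trans (HC K' m' (inv u a) nm); apply: ev_le => [|z];
    first exact: sublaw_pow.
  case H : (shadow C' _ _ _) => //.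
  by rewrite (shadow_mono _ H) // /C' le_max lexx.
have sub n' : sublaw (pow_law (th K') n') by exact: sublaw_pow.
apply: (@le_trans _ _ (ev (pow_law (th K') n) (fun u => (B < len u)%R%:R + phi
  u))).
  apply: ev_le => // u; case: (ltP B (len u)) => uB.
    rewrite -[leLHS]addr0; apply: lerD; last by apply: ev_ge0.
    by apply: ev_le_cst => // z; case: shadow.
  rewrite add0r; apply: ev_le => // z; rewrite isom_mulE.
  by case H: (shadow _ _ _ _) => //; rewrite (shadow_shift uB H).
rewrite evD.
have step : ev (pow_law (th K') n) phi <= q - al * (k%:R * q - 1).
  have -> : ev (pow_law (th K') n) phi = q * ev (pow_law (th K') n) (fun=> 1) -
      ev (pow_law (th K') n) (fun u => q - phi u).
    by rewrite evB [ev _ (fun=> q)]ev_cst; lra.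
  apply: lerB; first by rewrite ler_piMr //; case: (sub n).
  apply: le_trans (HK0 K' (fun u => q - phi u) (leq_maxr _ _) _); last first.
    by move=> u; rewrite subr_ge0.
  rewrite ler_wpM2l ?(ltW al0) //.
  have [i0 Hi0] := sep a.
  rewrite (bigD1 i0) //= -[leLHS]add0r lerD ?subr_ge0 // sumrB lerB //.
    rewrite (eq_bigl (mem (predC1 i0))) ?sumr_const; last by move=> i;
      rewrite !inE.
    by rewrite cardC1 card_ord /= mulr_natl.
  rewrite -ev_sum; apply: ev_le_cst => // z.
  case: (pickP (fun i => (i != i0) && shadow C' L (inv (us i) a) (z o))) =>
    [i /andP[ii0 Hi]|none].
    rewrite (bigD1 i) //= big1 ?addr0 ?Hi // => j /andP[ji0 ji].
    case Hj : (shadow _ _ _ _) => //.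
    have CD : D <= C' by rewrite le_max lexx orbT.
    by rewrite (Hi0 _ _ _ _ CD ii0 ji0 Hi Hj) eqxx in ji.
  rewrite big1 // => i ii0; have := none i; rewrite ii0 /= => ->.
  by [].
by have := HB K'; lra.
Qed.

(** As long as the optimal bound exceeds [eta], a number of elements larger than
[2 / eta] lowers it by a fixed amount. *)
Lemma schottky_unconcentrated L eta : schottky -> 0 <= L -> 0 < eta ->
  unconcentrated L eta.
Proof.
move=> Hs L0 eta0; apply: contrapT => neta.
have eta_lt q : unconcentrated L q -> eta < q.
  move=> [C [n0 Hq]]; rewrite ltNge; apply/negP => qeta; apply: neta.
  by exists C, n0 => K n a nn; apply: le_trans (Hq K n a nn) qeta.
have [k hk] : exists k : nat, 2 <= k%:R * eta.
  exists (Num.truncn (2 / eta)).+1.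
  by rewrite -ler_pdivrMr // ltW // truncnS_gt.
have [al al0 Hal] := unconcentrated_improve k Hs L0.
have iter m : unconcentrated L (1 - m%:R * (al / 2)).
  elim: m => [|m IH].
    exists 0, 0%N => K n a _; rewrite mul0r subr0.
    apply: ev_le_cst => // [|z]; first exact: sublaw_pow.
    by case: shadow.
  set q := 1 - _ in IH; have qeta := eta_lt _ IH.
  have [||C [n0 H]] := Hal q (al / 2) _ _ IH; [lra|lra|].
  exists C, n0 => K n a nn; apply: le_trans (H K n a nn) _.
  have : 2 <= k%:R * q by apply: (le_trans hk); rewrite ler_wpM2l // ltW.
  move=> hq; have : al * 1 <= al * (k%:R * q - 1) by rewrite ler_wpM2l
    ?(ltW al0) //; lra.
  have : q = 1 - m%:R * (al / 2) by [].
  by rewrite -[m.+1%:R]natr1; lra.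
have := eta_lt _ (iter (Num.truncn (1 / (al / 2))).+1).
have : 1 / (al / 2) < (Num.truncn (1 / (al / 2))).+1%:R by exact: truncnS_gt.
by rewrite ltr_pdivrMr ?divr_gt0 //; lra.
Qed.

End Family.
End Concentration.

(** * Ping-pong *)
(** Two combs with different [i <= k] fork within their first [k] letters,
however large [J] is. As they are palindromes, the inverse of a comb is the same
comb in the inverse letters, so that inverses fork early too. *)
Definition comb J i : seq bool := nseq i false ++ nseq (J - i.*2) true ++ nseq i
  false.

Lemma size_comb J i : (i.*2 <= J)%N -> size (comb J i) = J.
Proof. by move=> iJ; rewrite !size_cat !size_nseq; lia. Qed.

Lemma rev_comb J i : rev (comb J i) = comb J i.
Proof. by rewrite /comb !rev_cat !rev_nseq catA. Qed.

Section PingPong.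
Context {R : realType} {X : metricType R} (o : X).
Local Notation G := (bij_isometry X).
Local Notation gp := gromov_product.
Local Notation inv := isometry_inv.
Local Notation len := (len o).
Variable delta : R.
Hypothesis delta_ge0 : 0 <= delta.
Hypothesis hyp : forall x y z a : X,
  Num.min (gp x y a) (gp y z a) - delta <= gp x z a.
Implicit Types (s t u f g : G) (a b : X).

Section Words.
Variables (D : R) (letter : bool -> G).
Hypothesis D_ge0 : 0 <= D.
Hypothesis turn : forall x y, gp (inv (letter x) o) (letter y o) o <= D.
Hypothesis long : forall x, 2 * D + 3 * delta + 1 <= len (letter x).

Definition bword (w : seq bool) : G := prodw (map letter w).

Lemma bword_cat v w : bword (v ++ w) = (bword v * bword w)%g.
Proof. by rewrite /bword map_cat prodw_cat. Qed.

(** A local condition on consecutive letters controls the whole word: each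
letter is long enough to absorb the error [delta] made at the next turn. *)
Lemma bword_no_backtrack x w : gp (inv (letter x) o) (bword w o) o <= D + delta.
Proof.
elim: w x => [|y w IH] x; first by rewrite gpC gp_base addr_ge0.
apply: (hyp_le hyp (turn x y)); rewrite /bword /= isom_mulE gp_flip gpC.
by have := IH y; rewrite /bword; have := long y; move: D_ge0 delta_ge0; lra.
Qed.

Lemma len_bword_cons x w : len (bword w) + 1 <= len (bword (x :: w)).
Proof.
rewrite {2}/len /bword /= isom_mulE dist_isom -/(bword w).
have := bword_no_backtrack x w; have := long x.
by rewrite -/(len (bword w)); move: delta_ge0; lra.
Qed.

Lemma len_bword w : (size w)%:R <= len (bword w).
Proof.
elim: w => [|x w IH]; first exact: len_ge0.
by apply: le_trans (len_bword_cons x w); rewrite /= -natr1 lerD2r.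
Qed.

Lemma bword_follows x w : D + 2 * delta + 1 <= gp (bword (x :: w) o)
  (letter x o) o.
Proof.
rewrite /bword /= isom_mulE gp_flip gpC.
by have := bword_no_backtrack x w; rewrite /bword; have := long x; lra.
Qed.

Hypothesis fork : gp (letter true o) (letter false o) o <= D.

Lemma bword_fork w w' : gp (bword (true :: w) o) (bword (false :: w') o) o <= D
  + 2 * delta.
Proof.
have H1 := bword_follows true w; have H2 := bword_follows false w'.
have : gp (letter true o) (bword (false :: w') o) o <= D + delta.
  by apply: (hyp_le hyp fork); move: delta_ge0; lra.
move=> H3; rewrite gpC in H3; rewrite gpC.
apply: (le_trans (hyp_le hyp H3 _)); last by lra.
by move: delta_ge0; lra.
Qed.

Lemma bword_fork_prefix c w w' :
  gp (bword (c ++ true :: w) o) (bword (c ++ false :: w') o) o <=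
  len (bword c) + D + 2 * delta.
Proof.
rewrite !bword_cat !isom_mulE -(gp_isom (inv (bword c))) !isom_invK.
have := gp_lip_base (bword (true :: w) o) (bword (false :: w') o)
  (inv (bword c) o) o.
have := bword_fork w w'; rewrite metric_sym.
by have := len_inv o (bword c); rewrite {1}/len; lra.
Qed.

Lemma len_bword_nseq x n : len (bword (nseq n x)) <= n%:R * len (letter x).
Proof.
elim: n => [|n IH]; first by rewrite len1 mul0r.
rewrite [bword _]/= -/(bword (nseq n x)); apply: (le_trans (lenM_le _ _ _)).
by rewrite -natr1; lra.
Qed.

Lemma comb_fork J k i j : (i < j)%N -> (j <= k)%N -> (k.*2 < J)%N ->
  gp (bword (comb J i) o) (bword (comb J j) o) o <=
  k%:R * len (letter false) + D + 2 * delta.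
Proof.
move=> ij jk kJ.
have -> : comb J i = nseq i false ++ true :: (nseq (J - i.*2).-1 true ++ nseq i
  false).
  rewrite /comb; congr (_ ++ _); have -> : (J - i.*2 = (J - i.*2).-1.+1)%N by
    lia.
  by [].
have -> : comb J j = nseq i false ++ false :: (nseq (j - i.+1) false ++
    nseq (J - j.*2) true ++ nseq j false).
  have E : nseq j false = nseq i false ++ false :: nseq (j - i.+1) false.
    by rewrite -{1}(subnKC ij) addSnnS nseqD.
  by rewrite /comb {1}E -catA.
apply: (le_trans (bword_fork_prefix _ _ _)).
rewrite -!addrA lerD2r; apply: (le_trans (len_bword_nseq _ _)).
by rewrite ler_wpM2r ?len_ge0 // ler_nat; lia.
Qed.

End Words.

(** If [a] leaves the direction of [us i o] early then [inv (us i) a] is far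
along the direction of [inv (us i) o], and these directions are pairwise apart.
Since the directions of the [us i o] are pairwise apart as well, [a] follows at
most one of them. *)
Lemma disjoint_shadows (k : nat) (us : 'I_k.+1 -> G) (D L : R) :
  0 <= D -> 0 <= L ->
  (forall i j, i != j -> gp (us i o) (us j o) o <= D) ->
  (forall i j, i != j -> gp (inv (us i) o) (inv (us j) o) o <= D) ->
  (forall i, 3 * D + 5 * delta + L + 1 <= len (us i)) ->
  forall a, exists i0, forall C y i j, D + 3 * delta + L <= C -> i != i0 ->
    j != i0 ->
    shadow o C L (inv (us i) a) y -> shadow o C L (inv (us j) a) y -> i = j.
Proof.
move=> D0 L0 Hu Hv Hl a.
have [i0 Hi0] : exists i0, forall i, i != i0 -> gp a (us i o) o <= D + delta.
  case: (pickP (fun i => D + delta < gp a (us i o) o)) => [i0 Hi0|none];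
    last first.
    by exists ord0 => i _; rewrite leNgt none.
  exists i0 => i ii0; rewrite gpC; apply: (hyp_le hyp (Hu _ _ ii0)) => //.
exists i0 => C y i j HC ii0 ji0 Hi Hj; apply/eqP; apply: contraT => ij.
pose h i := inv (us i).
have far l : l != i0 -> 2 * D + 4 * delta + L + 1 <= gp (h l a) (h l o) o.
  move=> /Hi0; rewrite gp_flip /h isometry_invI len_inv.
  by have := Hl l; lra.
have Fi := far i ii0; have Fj := far j ji0.
have sep : gp (h i a) (h j a) o <= D + 2 * delta.
  have H1 : gp (h i o) (h j a) o <= D + delta.
    by apply: (hyp_le hyp (Hv _ _ ij)); move: delta_ge0; lra.
  rewrite gpC in H1; rewrite gpC; apply: le_trans (hyp_le hyp H1 _) _;
    last by lra.
  by move: delta_ge0; lra.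
have out l : l != i0 -> D + 3 * delta + L + 1 <= mdist o (h l a).
  move=> /Hi0; rewrite dist_isom /h isometry_invI len_inv gpC.
  by have := Hl l; have := mdist_ge0 o a; lra.
have dij : 2 * L + 2 <= mdist (h i a) (h j a).
  have := out i ii0; have := out j ji0; move: sep; rewrite /gp.
  rewrite (metric_sym (h i a) o); move: delta_ge0 D0 L0; lra.
have contra1 l m : gp (h l a) (h m a) o <= D + 2 * delta ->
    C < gp (h l a) y o -> mdist (h m a) y <= L -> False.
  move=> H1 H2 H3; have := gp_lip (h l a) y (h m a) o.
  by rewrite metric_sym; move: delta_ge0; lra.
case/orP: Hi => Hi; case/orP: Hj => Hj.
- have Hj' : C < gp y (h j a) o by rewrite gpC.
  have := hyp (h i a) y (h j a) o; rewrite /Num.min.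
  by case: ifP => _; move: Hi Hj' sep HC delta_ge0 L0; rewrite /h; lra.
- by have := contra1 i j sep Hi Hj.
- by rewrite gpC in sep; have := contra1 j i sep Hj Hi.
- have := metric_triangle (h i a) y (h j a).
  by move: dij L0 Hi Hj; rewrite (metric_sym y) /h; lra.
Qed.

End PingPong.

(** * Loxodromic axes and their ends *)
Section Loxodromic.
Context {R : realType} {X : metricType R} (o : X).
Local Notation G := (bij_isometry X).
Local Notation gp := gromov_product.
Local Notation inv := isometry_inv.
Local Notation len := (len o).
Variable delta : R.
Hypothesis delta_ge0 : 0 <= delta.
Hypothesis hyp : forall x y z a : X,
  Num.min (gp x y a) (gp y z a) - delta <= gp x z a.
Implicit Types (s f g x : G) (a b : X).

Lemma npow_prodw x n : (x ^+ n)%g = prodw (nseq n x).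
Proof. by elim: n => [|n IH]; rewrite ?expg0 // expgS IH. Qed.

Lemma expgD x m n : (x ^+ (m + n))%g = (x ^+ m * x ^+ n)%g.
Proof. by rewrite !npow_prodw nseqD prodw_cat. Qed.

Lemma inv_expg x n : inv (x ^+ n)%g = (inv x ^+ n)%g.
Proof.
by rewrite !npow_prodw -prodw_inv_rev rev_nseq map_nseq.
Qed.

Lemma expg_commutes x n : (x ^+ n * x)%g = (x * x ^+ n)%g.
Proof. by rewrite -expgS -addn1 expgD expgS expg0 mulg1. Qed.

Lemma inv_mulV x : (x * inv x)%g = 1%g.
Proof. by rewrite -{1}(isometry_invI x) isometry_inv_mul. Qed.

(** The orbit is a quasi-geodesic: it escapes linearly, and its two halves do
not come back along each other. *)
Definition axis x (D : R) : Prop := (forall n, n%:R <= len (x ^+ n)%g) /\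
  forall m n, gp (inv (x ^+ m)%g o) ((x ^+ n)%g o) o <= D.

Lemma axis_inv x D : axis x D -> axis (inv x) D.
Proof.
case=> H1 H2; split=> [n|m n]; first by rewrite -inv_expg len_inv.
by rewrite -inv_expg isometry_invI -inv_expg gpC.
Qed.

Lemma axis_ge0 x D : axis x D -> 0 <= D.
Proof. by case=> _ /(_ 0%N 0%N); apply: le_trans; exact: gp_ge0. Qed.

(** As [len (x * x) = 2 * len x - 2 * (inv x o | x o)], the hypothesis says that
the turn at [o] is small compared to [len x], which is the local condition on
words for the powers of [x]. *)
Lemma axis_of_square x : len x + 3 * delta + 1 <= len (x * x)%g -> exists D,
  axis x D.
Proof.
move=> xx; pose D := gp (inv x o) (x o) o.
have D0 : 0 <= D by exact: gp_ge0.
have xL : 2 * D + 3 * delta + 1 <= len x.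
  by move: xx; rewrite /(len (x * x)%g) isom_mulE dist_isom -/D -/(len x); lra.
have bwE n : bword (fun=> x) (nseq n true) = (x ^+ n)%g.
  by rewrite /bword map_nseq npow_prodw.
have bwE' n : bword (fun=> inv x) (nseq n true) = inv (x ^+ n)%g.
  by rewrite /bword map_nseq inv_expg npow_prodw.
have turn : forall _ _ : bool, gp (inv x o) (x o) o <= D by [].
have turn' : forall _ _ : bool, gp (inv (inv x) o) (inv x o) o <= D.
  by move=> _ _; rewrite isometry_invI gpC.
have xL' : 2 * D + 3 * delta + 1 <= len (inv x) by rewrite len_inv.
exists (D + 2 * delta); split=> [n|[|m] n].
- have := len_bword delta_ge0 hyp D0 turn (fun=> xL) (nseq n true).
  by rewrite size_nseq bwE.
- rewrite expg0 isometry_inv1 gp_base; apply: addr_ge0; first exact: D0.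
  by apply: mulr_ge0; [exact: ler0n|exact: delta_ge0].
have H1 := bword_no_backtrack delta_ge0 hyp D0 turn (fun=> xL) true
  (nseq n true).
have H2 := bword_follows delta_ge0 hyp D0 turn' (fun=> xL') true (nseq m true).
rewrite bwE gpC in H1; rewrite gpC -bwE'; clear turn turn'.
apply: le_trans (hyp_le hyp H1 _) _; last by lra.
by move: H2; rewrite /=; move: delta_ge0; lra.
Qed.

(** Since [len (f ^+ n)] is close to [tau * n], doubling a large exponent [e]
increases the length by almost [tau * e]. *)
Lemma loxodromic_axis f : loxodromic o f ->
  exists2 e, (0 < e)%N & exists D, axis (f ^+ e)%g D.
Proof.
move=> [tau tau0 /cvgrPdist_le flim].
have [|N _ HN] := flim (tau / 10); first by rewrite divr_gt0.
pose K := 3 * delta + 1.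
pose e := maxn N.+1 (Num.truncn (K / (tau * 7 / 10))).+1.
have e0 : (0 < e)%N by rewrite leq_max.
exists e => //; apply: axis_of_square.
have eR : 0 < e%:R :> R by rewrite ltr0n.
have bound n : (e <= n)%N -> `|tau * n%:R - len (f ^+ n)%g| <= tau / 10 * n%:R.
  move=> en; have nR : 0 < n%:R :> R by rewrite ltr0n (leq_trans e0).
  have /= := HN n (leq_trans (leq_trans (leqnSn N) (leq_maxl _ _)) en).
  by rewrite -(ler_pM2r nR) -{2}(gtr0_norm nR) -normrM mulrBl divfK // gt_eqF.
have := bound e (leqnn e); have := bound (e + e)%N (leq_addr _ _).
rewrite !ler_norml -expgD natrD => /andP[_ H1] /andP[H2 _].
have : K <= tau * 7 / 10 * e%:R.
  rewrite mulrC -ler_pdivrMr; last by move: tau0; lra.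
  apply: le_trans (ltW (truncnS_gt _)) _; rewrite ler_nat; exact: leq_maxr.
by rewrite /K; lra.
Qed.

Lemma axis_diverges x D m n : axis x D -> (m <= n)%N ->
  len (x ^+ m)%g - D <= gp ((x ^+ m)%g o) ((x ^+ n)%g o) o.
Proof.
move=> [_ H] mn; rewrite -(subnKC mn) expgD isom_mulE gpC gp_flip gpC.
by have := H m (n - m)%N; lra.
Qed.

Lemma axis_converges x D : axis x D ->
  converge_together o (fun n => (x ^+ n)%g o) (fun n => (x ^+ n)%g o).
Proof.
move=> Hx M; exists (Num.truncn (M + D)).+1 => m n.
wlog mn : m n / (m <= n)%N => [H Hm Hn|Hm Hn].
  by have /orP[mn|nm] := leq_total m n; [exact: H|rewrite gpC; exact: H].
apply: le_trans (axis_diverges Hx mn); case: Hx => + _ => /(_ m).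
have := truncnS_gt (M + D); have : (Num.truncn (M + D)).+1%:R <= m%:R :> R by
  rewrite ler_nat.
lra.
Qed.

Definition end_of (u : nat -> X) : set (nat -> X) :=
  [set v | converge_together o v v /\ converge_together o u v].

Lemma converge_together_trans (u v w : nat -> X) :
  converge_together o u v -> converge_together o v w -> converge_together o u w.
Proof.
move=> uv vw M; have [N1 H1] := uv (M + delta); have [N2 H2] := vw (M + delta).
exists (maxn N1 N2) => m n; rewrite !geq_max => /andP[m1 m2] /andP[n1 n2].
have := hyp (u m) (v (maxn m n)) (w n) o.
have := H1 m (maxn m n) m1 (leq_trans m1 (leq_maxl _ _)).
have := H2 (maxn m n) n (leq_trans n2 (leq_maxr _ _)) n2.
by rewrite /Num.min; case: ifP => _; lra.
Qed.

Lemma converge_togetherC (u v : nat -> X) :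
  converge_together o u v -> converge_together o v u.
Proof. by move=> uv M; have [N H] := uv M; exists N => m n Hm Hn;
  rewrite gpC H. Qed.

Lemma end_of_eq u v : converge_together o u v -> end_of u = end_of v.
Proof.
move=> uv; have vu := converge_togetherC uv.
by apply/seteqP; split=> w [ww uw]; split=> //;
  apply: converge_together_trans uw.
Qed.

(** An isometry that commutes with [x] moves all the points of the orbit of [o]
by the same distance, and bounded perturbations do not change the class at
infinity. *)
Lemma axis_end_fixed f x D : axis x D -> (f * x)%g = (x * f)%g ->
  fixed_at_infinity o f (end_of (fun n => (x ^+ n)%g o)).
Proof.
move=> Hx fx; set u := fun n => _.
have uu : converge_together o u u by exact: axis_converges Hx.
split; first by exists u.
have stable h : (h * x)%g = (x * h)%g -> forall v, end_of u v ->
  end_of u (h \o v).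
  move=> hx v [vv uv]; split=> M.
    have [N HN] := vv (M + len h); exists N => m n Hm Hn.
    rewrite -(gp_isom (inv h)) !isom_invK.
    have := gp_lip_base (v m) (v n) o (inv h o).
    by have := HN m n Hm Hn; have := len_inv o h; rewrite {1}/len; lra.
  have [N HN] := uv (M + 2 * len h); exists N => m n Hm Hn.
  have hxm : (h * x ^+ m)%g = (x ^+ m * h)%g.
    elim: (m) => [|k IH]; first by rewrite expg0 mulg1 mul1g.
    by rewrite expgS mulgA hx -mulgA IH mulgA.
  have close : mdist (h (u m)) (u m) = len h.
    by rewrite /u -isom_mulE hxm isom_mulE isometry_mdist metric_sym.
  have := gp_lip (h (v n)) (h (u m)) (u m) o.
  have := gp_lip_base (u m) (v n) o (inv h o).
  have -> : gp (h (v n)) (h (u m)) o = gp (u m) (v n) (inv h o).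
    by rewrite gpC -(gp_isom (inv h)) !isom_invK.
  rewrite close [gp (h (v n)) _ _]gpC.
  by have := HN m n Hm Hn; have := len_inv o h; rewrite {1}/len /=; lra.
apply/seteqP; split=> [_ [v Hv <-]|v Hv]; first exact: stable.
exists (inv f \o v); last by apply/funext => n; rewrite /= isom_invKV.
apply: stable => //.
by rewrite -[in LHS](mulg1 x) -(inv_mulV f) !mulgA -(mulgA _ x) -fx !mulgA
  isometry_inv_mul mul1g.
Qed.

(** Points of an axis are passed on the way to later ones ([axis_diverges]), so
a pair of points with a small product bounds the products of all the pairs
preceding it. Sequences that do not converge together have such pairs, with the
same bound [M], arbitrarily far. *)
Lemma axes_apart x y D E : axis x D -> axis y E ->
  ~ converge_together o (fun n => (x ^+ n)%g o) (fun n => (y ^+ n)%g o) ->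
  exists B, forall i j, gp ((x ^+ i)%g o) ((y ^+ j)%g o) o <= B.
Proof.
move=> Hx Hy /existsNP[M /forallNP HM].
exists (M + D + E + 2 * delta) => i j.
have /existsNP[m /existsNP[n]] := HM (maxn i j).
move=> /not_implyP[+ /not_implyP[+ /negP]].
rewrite !geq_max -ltNge => /andP[im jm] /andP[in_ jn] mn.
have H1 := axis_diverges Hx im; have H2 := axis_diverges Hy jn.
have D0 := axis_ge0 Hx; have E0 := axis_ge0 Hy.
set t := gp _ _ o.
have t1 : t <= len (x ^+ i)%g by exact: gp_le_dist.
have t2 : t <= len (y ^+ j)%g by rewrite /t gpC; exact: gp_le_dist.
have := hyp ((x ^+ m)%g o) ((x ^+ i)%g o) ((y ^+ j)%g o) o.
have := hyp ((x ^+ m)%g o) ((y ^+ j)%g o) ((y ^+ n)%g o) o.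
rewrite [gp ((x ^+ m)%g o) ((x ^+ i)%g o) o]gpC -/t /Num.min.
by case: ifP => _; case: ifP => _; move: delta_ge0; lra.
Qed.

End Loxodromic.

(** * Schottky families in the support *)
Section Schottky.
Context {R : realType} {X : metricType R} (o : X).
Local Notation G := (bij_isometry X).
Local Notation gp := gromov_product.
Local Notation inv := isometry_inv.
Local Notation len := (len o).
Variable delta : R.
Hypothesis delta_ge0 : 0 <= delta.
Hypothesis hyp : forall x y z a : X,
  Num.min (gp x y a) (gp y z a) - delta <= gp x z a.
Implicit Types (th : nat -> seq (R * G)) (f g x y u v : G).

Lemma charged1 th : charged th 0 1%g.
Proof.
exists 1 => //; exists 0%N => K f _ f0.
by rewrite ev_pow ev_words0 mul1r.
Qed.

Lemma chargedM th m n u v : exhausting th ->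
  charged th m u -> charged th n v -> charged th (m + n) (u * v)%g.
Proof.
move=> [Hsub _ _] [al al0 [K1 H1]] [be be0 [K2 H2]].
exists (al * be); first exact: mulr_gt0.
exists (maxn K1 K2) => K f; rewrite geq_max => /andP[k1 k2] f0.
rewrite ev_powD -mulrA.
apply: le_trans (H1 K (fun s => ev (pow_law (th K) n) (fun t => f (s * t)%g)) k1
  _).
  by rewrite ler_wpM2l ?(ltW al0) //; apply: H2.
by move=> s; apply: ev_ge0 => //; exact: sublaw_pow.
Qed.

Lemma charged_prodw th n (w : seq G) : exhausting th ->
  (forall s, s \in w -> charged th n s) -> charged th (size w * n) (prodw w).
Proof.
move=> Hth; elim: w => [|s w IH] Hw; first exact: charged1.
rewrite mulSn; apply: chargedM => //; first by apply: Hw; rewrite mem_head.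
by apply: IH => t tw; apply: Hw; rewrite in_cons tw orbT.
Qed.

Lemma charged_expg th n u k : exhausting th ->
  charged th n u -> charged th (n * k) (u ^+ k)%g.
Proof.
move=> Hth Hu; rewrite npow_prodw mulnC -{1}(size_nseq k u).
by apply: charged_prodw => // s /nseqP[->].
Qed.

Lemma charged_inv th n u : charged th n u -> charged (inv_law \o th) n (inv u).
Proof.
case=> al al0 [K0 H]; exists al => //; exists K0 => K f KK f0.
by rewrite /= -inv_pow ev_map; apply: (H K (fun s => f (inv s))).
Qed.

Definition independent x y (D : R) : Prop := [/\ axis o x D, axis o y D &
  forall i j, [/\ gp ((x ^+ i)%g o) ((y ^+ j)%g o) o <= D,
    gp (inv (x ^+ i)%g o) ((y ^+ j)%g o) o <= D,
    gp ((x ^+ i)%g o) (inv (y ^+ j)%g o) o <= D &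
    gp (inv (x ^+ i)%g o) (inv (y ^+ j)%g o) o <= D]].

Lemma independent_inv x y D : independent x y D -> independent (inv x) (inv y)
  D.
Proof.
case=> Hx Hy H; split=> [||i j]; [exact: axis_inv|exact: axis_inv|].
by have [? ? ? ?] := H i j; split; rewrite -!inv_expg ?isometry_invI.
Qed.

(** The exponents [q * n] and [p * n] make the powers of [x] and [y] long, for
ping-pong, and charged at the same time. Combs of the same size in these two
letters are then charged at the same time too. *)
Lemma independent_schottky th x y D p q : exhausting th -> (0 < p)%N ->
  (0 < q)%N ->
  charged th p x -> charged th q y -> independent x y D -> schottky o th.
Proof.
move=> Hth p0 q0 cx cy [Hx Hy Hxy] k L L0.
have D0 := axis_ge0 Hx.
pose n := (Num.truncn (2 * D + 3 * delta + 1)).+1.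
have nL : 2 * D + 3 * delta + 1 <= n%:R by exact/ltW/truncnS_gt.
pose F := (x ^+ (q * n))%g; pose H := (y ^+ (p * n))%g.
pose letter (b : bool) := if b then F else H.
pose letter' b := inv (letter b).
have cl b : charged th (p * q * n) (letter b).
  rewrite /letter; case: b; last rewrite (mulnC p).
    by rewrite -mulnA; exact: charged_expg.
  by rewrite -mulnA; exact: charged_expg.
have long b : 2 * D + 3 * delta + 1 <= len (letter b).
  apply: (le_trans nL); rewrite /letter; case: b.
    by case: Hx => /(_ (q * n)%N) + _; apply: le_trans;
      rewrite ler_nat leq_pmull.
  by case: Hy => /(_ (p * n)%N) + _; apply: le_trans; rewrite ler_nat leq_pmull.
have [_ Hx2] := Hx; have [_ Hy2] := Hy.
have [h1 h2 h3 h4] := Hxy (q * n)%N (p * n)%N.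
have turn b c : gp (inv (letter b) o) (letter c o) o <= D.
  by rewrite /letter; case: b; case: c; rewrite ?Hx2 ?Hy2 // gpC.
have turn' b c : gp (inv (letter' b) o) (letter' c o) o <= D.
  by rewrite /letter' isometry_invI gpC turn.
have fork : gp (letter true o) (letter false o) o <= D by [].
have fork' : gp (letter' true o) (letter' false o) o <= D by [].
have long' b : 2 * D + 3 * delta + 1 <= len (letter' b) by rewrite len_inv.
pose D1 := k%:R * len H + D + 2 * delta.
have D1_ge0 : 0 <= D1 by rewrite !addr_ge0 ?mulr_ge0 ?len_ge0.
pose l := (Num.truncn (3 * D1 + 5 * delta + L + 1)).+1.
have lL : 3 * D1 + 5 * delta + L + 1 <= l%:R by exact/ltW/truncnS_gt.
pose J := (k.*2 + l)%N.
have kJ : (k.*2 < J)%N by rewrite /J; lia.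
pose us (i : 'I_k.+1) := bword letter (comb J i).
have usV i : inv (us i) = bword letter' (comb J i).
  rewrite /us /bword -prodw_inv_rev -map_rev rev_comb -map_comp.
  by congr prodw; apply: eq_map.
have iJ (i : 'I_k.+1) : (i.*2 <= J)%N by have := ltn_ord i; rewrite /J; lia.
have [Hu Hv] : (forall i j, i != j -> gp (us i o) (us j o) o <= D1) /\
    (forall i j, i != j -> gp (inv (us i) o) (inv (us j) o) o <= D1).
  split.
    move=> i j ij; wlog lij : i j ij / (i < j)%N => [W|].
      have [/W|/W|/val_inj/eqP] := ltngtP i j; first exact.
        by rewrite gpC eq_sym; apply.
      by rewrite (negPf ij).
    apply: (comb_fork delta_ge0 hyp D0 turn long fork lij _ kJ).
    by rewrite -ltnS.
  move=> i j ij; rewrite !usV; wlog lij : i j ij / (i < j)%N => [W|].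
    have [/W|/W|/val_inj/eqP] := ltngtP i j; first exact.
      by rewrite gpC eq_sym; apply.
    by rewrite (negPf ij).
  apply: le_trans (comb_fork delta_ge0 hyp D0 turn' long' fork' lij _ kJ) _.
    by rewrite -ltnS.
  by rewrite /letter' len_inv.
have Hl i : 3 * D1 + 5 * delta + L + 1 <= len (us i).
  apply: (le_trans lL); apply: le_trans (len_bword delta_ge0 hyp D0 turn long
    _).
  by rewrite size_comb // ler_nat leq_addl.
exists (J * (p * q * n))%N, (D1 + 3 * delta + L), us; split; last first.
  exact: (disjoint_shadows delta_ge0 hyp).
move=> i; have -> : J = size (map letter (comb J i)) by rewrite size_map
  size_comb.
by apply: charged_prodw => // s /mapP[b _ ->].
Qed.

(** Each end of one axis is compared with each end of the other. A common end
would be fixed by [f] and by [g], which commute with their powers. *)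
Lemma loxodromic_independent f g : loxodromic o f -> loxodromic o g ->
  fixed_at_infinity o f `&` fixed_at_infinity o g = set0 ->
  exists e e' D, [/\ (0 < e)%N, (0 < e')%N & independent (f ^+ e)%g (g ^+ e')%g
    D].
Proof.
move=> /(loxodromic_axis delta_ge0 hyp)[e e0 [D Hx]].
move=> /(loxodromic_axis delta_ge0 hyp)[e' e'0 [D' Hy]] disj.
set x := (f ^+ e)%g in Hx; set y := (g ^+ e')%g in Hy.
have fx : (f * x)%g = (x * f)%g by rewrite /x expg_commutes.
have gy : (g * y)%g = (y * g)%g by rewrite /y expg_commutes.
have commV (h z : G) : (h * z)%g = (z * h)%g -> (h * inv z)%g = (inv z * h)%g.
  move=> hz; rewrite -[in LHS](mul1g h) -(isometry_inv_mul z) -!mulgA.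
  by rewrite (mulgA z) -hz -mulgA inv_mulV mulg1.
have apart x' y' E E' : axis o x' E -> axis o y' E' ->
    (f * x')%g = (x' * f)%g -> (g * y')%g = (y' * g)%g ->
    exists B, forall i j, gp ((x' ^+ i)%g o) ((y' ^+ j)%g o) o <= B.
  move=> Hx' Hy' fx' gy'; apply: (axes_apart delta_ge0 hyp Hx' Hy') => conv.
  have Ff := axis_end_fixed Hx' fx'; have Fg := axis_end_fixed Hy' gy'.
  rewrite (end_of_eq hyp conv) in Ff.
  by have : (fixed_at_infinity o f `&` fixed_at_infinity o g) _ := conj Ff Fg;
    rewrite disj.
have Hx' := axis_inv Hx; have Hy' := axis_inv Hy.
have [B1 H1] := apart _ _ _ _ Hx Hy fx gy.
have [B2 H2] := apart _ _ _ _ Hx' Hy (commV _ _ fx) gy.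
have [B3 H3] := apart _ _ _ _ Hx Hy' fx (commV _ _ gy).
have [B4 H4] := apart _ _ _ _ Hx' Hy' (commV _ _ fx) (commV _ _ gy).
pose M := Num.max (Num.max D D') (Num.max (Num.max B1 B2) (Num.max B3 B4)).
have mD : D <= M by rewrite !le_max lexx.
have mD' : D' <= M by rewrite !le_max lexx !orbT.
have m1 : B1 <= M by rewrite !le_max lexx !orbT.
have m2 : B2 <= M by rewrite !le_max lexx !orbT.
have m3 : B3 <= M by rewrite !le_max lexx !orbT.
have m4 : B4 <= M by rewrite !le_max lexx !orbT.
exists e, e', M; split=> //; split.
- by case: Hx => Ha Hb; split=> // i j; exact: le_trans (Hb i j) mD.
- by case: Hy => Ha Hb; split=> // i j; exact: le_trans (Hb i j) mD'.
move=> i j; rewrite -/x -/y (inv_expg x i) (inv_expg y j); split.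
- exact: le_trans (H1 i j) m1.
- exact: le_trans (H2 i j) m2.
- exact: le_trans (H3 i j) m3.
- exact: le_trans (H4 i j) m4.
Qed.

Lemma semigroup_charged th (S : set G) f : exhausting th ->
  (forall h, S h -> charged th 1 h) -> generated_semigroup S f ->
  exists2 n, (0 < n)%N & charged th n f.
Proof.
move=> Hth HS Sf; apply: (Sf [set u | exists2 n, (0 < n)%N & charged th n u]).
split=> [u v [m m0 Hu] [n n0 Hv]|h Sh]; last by exists 1%N => //; exact: HS.
by exists (m + n)%N; [rewrite addn_gt0 m0|exact: chargedM].
Qed.

Lemma non_elementary_schottky th (S : set G) f g : exhausting th ->
  (forall h, S h -> charged th 1 h) ->
  generated_semigroup S f -> generated_semigroup S g ->
  loxodromic o f -> loxodromic o g ->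
  fixed_at_infinity o f `&` fixed_at_infinity o g = set0 ->
  schottky o th /\ schottky o (inv_law \o th).
Proof.
move=> Hth HS Sf Sg lf lg disj.
have [p p0 cf] := semigroup_charged Hth HS Sf.
have [q q0 cg] := semigroup_charged Hth HS Sg.
have [e [e' [D [e0 e'0 ind]]]] := loxodromic_independent lf lg disj.
have cx := charged_expg e Hth cf; have cy := charged_expg e' Hth cg.
split.
  by apply: (independent_schottky Hth _ _ cx cy ind); rewrite muln_gt0 ?p0 ?q0.
apply: (independent_schottky _ _ _ (charged_inv cx) (charged_inv cy)
  (independent_inv ind)).
- exact: exhausting_inv.
- by rewrite muln_gt0 p0.
- by rewrite muln_gt0 q0.
Qed.

End Schottky.

(** * Blocks that are never undone *)
Section Undone.
Context {R : realType} {X : metricType R} (o : X).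
Local Notation G := (bij_isometry X).
Local Notation gp := gromov_product.
Local Notation inv := isometry_inv.
Local Notation len := (len o).
Variable delta : R.
Hypothesis delta_ge0 : 0 <= delta.
Hypothesis hyp : forall x y z a : X,
  Num.min (gp x y a) (gp y z a) - delta <= gp x z a.
Implicit Types (s : G) (u v w : seq G) (a b : X).

(** The constants depend on [C] and [delta] only, so that they can be chosen
before the length of the blocks. *)
Lemma decay_constants (C : R) : 0 <= C -> exists l' C1,
  [/\ 0 < l', C <= C1, expR (2 * (l' * delta)) <= 2, expR (l' * C) <= 2 &
      4 * expR (- l' * C1) <= expR (- l' * C)].
Proof.
move=> C0; have ln2 : 0 < ln 2 :> R by rewrite ln_gt0 // ltr1n.
have den : 0 < 2 * (C + delta + 1) by move: delta_ge0; lra.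
pose l' := ln 2 / (2 * (C + delta + 1)).
have l'0 : 0 < l' by rewrite divr_gt0.
have ln4 : 0 < ln 4 :> R by rewrite ln_gt0 // ltr1n.
have e2 : expR (ln 2) = 2 :> R by rewrite lnK // posrE.
have l'E : l' * (2 * (C + delta + 1)) = ln 2 by rewrite divfK // gt_eqF.
exists l', (C + ln 4 / l'); split=> //.
- by rewrite lerDl ltW // divr_gt0.
- rewrite -[leRHS]e2 ler_expR -l'E mulrCA ler_wpM2l ?(ltW l'0) //; lra.
- rewrite -[leRHS]e2 ler_expR -l'E ler_wpM2l ?(ltW l'0) //.
  by move: delta_ge0; lra.
- have -> : - l' * (C + ln 4 / l') = - l' * C - ln 4.
    by rewrite mulNr mulrDr [l' * (_ / _)]mulrC divfK ?gt_eqF // opprD mulNr.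
  by rewrite expRD expRN lnK ?posrE // mulrCA mulfV ?mulr1 // gt_eqF.
Qed.

Definition shadowed (C1 : R) a v : bool :=
  has (fun j => C1 < gp a (prodw (take j v) o) o) (iota 0 (size v).+1).

Section Letters.
Variables (th : seq (R * G)) (C C1 nu l' : R).
Hypothesis Hth : sublaw th.
Hypothesis C_ge0 : 0 <= C.
Hypothesis l'_gt0 : 0 < l'.
Hypothesis l'_delta : expR (2 * (l' * delta)) <= 2.
Hypothesis l'_C : expR (l' * C) <= 2.
Hypothesis C1_large : 4 * expR (- l' * C1) <= expR (- l' * C).
Hypothesis nu_ge0 : 0 <= nu.
Hypothesis endpoint : forall n a, (0 < n)%N ->
  ev (words th n) (fun w => (C < gp a (prodw w o) o)%R%:R) <= nu ^+ 2.
Hypothesis returns : forall n a b, laplace o (inv_law th) l' n a b * 4 ^+ n <=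
  2.

Lemma shadowed_crossing a v n : size v = n -> (shadowed C1 a v)%:R <=
  8 * \sum_(j < n) expR (- l' * gp (prodw (take j v) o) (prodw (take j.+1 v) o)
    o) *
    (C < gp (prodw (take j.+1 v) o) a o)%R%:R.
Proof.
move=> vn; pose F j := expR (- l' * gp (prodw (take j v) o)
  (prodw (take j.+1 v) o) o) *
  (C < gp (prodw (take j.+1 v) o) a o)%R%:R.
have F0 j : 0 <= F j by rewrite mulr_ge0 ?expR_ge0.
rewrite /shadowed; case: hasP => [[j]|_]; last by rewrite mulr_ge0 ?sumr_ge0.
rewrite mem_iota add0n ltnS vn => /andP[_ jn] Hj.
have Hj' : C1 < gp (prodw (take j v) o) a o by rewrite gpC.
have := crossing_bound delta_ge0 hyp C_ge0 l'_gt0 l'_delta C1_large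
  (o := o) (p := fun j => prodw (take j v) o) (y := a) (n := j).
rewrite take0 => /(_ erefl Hj') /le_trans; apply.
apply: (@le_trans _ _ (8 * \sum_(i < j) F i)).
  by rewrite ler_wpM2r ?sumr_ge0 //; move: l'_C; lra.
rewrite ler_wpM2l // -(big_mkord xpredT F) -[leRHS](big_mkord xpredT F).
rewrite [leRHS](big_cat_nat (n := j)) //=.
by rewrite lerDl sumr_ge0.
Qed.

(** By [crossing_bound] the walk enters the shadow only if at some time [j] it
is near [o] and at a shallower depth of the shadow. The former has probability
of order [4 ^- j], the latter [nu ^+ 2]; they are not independent, but the
smaller of the two is at most their geometric mean [nu * 2 ^- j], which is
summable. *)
Lemma shadowed_le n a :
  ev (words th n) (fun v => (shadowed C1 a v)%:R) <= 32 * nu.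
Proof.
pose sg j v := expR (- l' * gp (prodw (take j v) o) (prodw (take j.+1 v) o) o).
pose ind j v : R := (C < gp (prodw (take j.+1 v) o) a o)%R%:R.
apply: (@le_trans _ _ (ev (words th n) (fun v => 8 * \sum_(j < n) sg j v * ind j
  v))).
  by apply: ev_words_le => // v vn; exact: shadowed_crossing.
rewrite evZ ev_sum (_ : 32 * nu = 8 * (4 * nu)); last by lra.
rewrite ler_wpM2l //.
have Esg j : (j < n)%N -> ev (words th n) (sg j) <= 2 * (4^-1) ^+ j.
  move=> jn; apply: (@le_trans _ _ (ev (words th j.+1) (sg j))).
    apply: (@le_trans _ _ (ev (words th n) (fun v => sg j (take j.+1 v)))).
      by apply: ev_words_le => // v _; rewrite /sg !take_takel.
    by apply: (ev_words_take (F := sg j)) => // v; exact: expR_ge0.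
  rewrite ev_words_rcons ev_swap; apply: ev_le_cst => // t.
  rewrite exprVn -ler_pdivrMr ?invr_gt0 ?exprn_gt0 // invrK.
  apply: le_trans (returns j o (t o)); rewrite ler_wpM2r ?exprn_ge0 //.
  rewrite /laplace (ev_inv_words th j (fun z => expR
    (- l' * gp o (t o) (z o)))).
  apply: ev_words_le => // u uj; rewrite /sg -cats1 take_size_cat //.
  rewrite take_oversize ?size_cat ?uj ?addn1 // prodw_cat /= mulg1 isom_mulE.
  by rewrite -(gp_isom (inv (prodw u))) !isom_invK.
have Eind j : (j < n)%N -> ev (words th n) (ind j) <= nu ^+ 2.
  move=> jn; apply: le_trans (endpoint a (ltn0Sn j)).
  apply: (@le_trans _ _ (ev (words th n) (fun v =>
      (C < gp a (prodw (take j.+1 v) o) o)%R%:R))).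
    by apply: ev_words_le => // v _; rewrite /ind gpC.
  exact: (ev_words_take (F := fun w => (C < gp a (prodw w o) o)%R%:R)).
have term j : (j < n)%N ->
    ev (words th n) (fun v => sg j v * ind j v) <= 2 * nu * (2^-1) ^+ j.
  move=> jn; set x := ev _ _.
  have Hw : sublaw (words th n) by exact: sublaw_words.
  have x0 : 0 <= x by apply: ev_ge0 => // v; rewrite mulr_ge0 ?expR_ge0.
  have x1 : x <= 2 * (4^-1) ^+ j.
    apply: le_trans (Esg j jn); apply: ev_le => // v.
    by rewrite ler_piMr ?expR_ge0 // /ind; case: (C < _).
  have x2 : x <= nu ^+ 2.
    apply: le_trans (Eind j jn); apply: ev_le => // v.
    rewrite ler_piMl // /sg -expR0 ler_expR mulNr oppr_le0.
    by rewrite mulr_ge0 ?(ltW l'_gt0) ?gp_ge0.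
  rewrite -(@ler_pXn2r _ 2) ?nnegrE ?mulr_ge0 ?exprn_ge0 ?invr_ge0 //.
  rewrite !exprMn -exprM mulnC exprM (_ : (2^-1) ^+ 2 = 4^-1 :> R); last first.
    by rewrite exprVn -natrX.
  have p0 : 0 <= (4^-1) ^+ j :> R by rewrite exprn_ge0 // invr_ge0.
  have n2 : 0 <= nu ^+ 2 by rewrite sqr_ge0.
  rewrite expr2; apply: le_trans (ler_pM x0 x0 x1 x2) _.
  have := mulr_ge0 p0 n2; move: (_ ^+ j) (nu ^+ 2) => p m.
  by rewrite expr2; lra.
apply: (@le_trans _ _ (\sum_(j < n) 2 * nu * (2^-1) ^+ j)).
  by apply: ler_sum => j _; exact: term.
rewrite -mulr_sumr.
have geom : \sum_(j < n) (2^-1) ^+ j <= 2 :> R.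
  have -> : \sum_(j < n) (2^-1) ^+ j = 2 * (1 - (2^-1) ^+ n) :> R.
    elim: n {Esg Eind term} => [|m IH]; first by rewrite big_ord0 expr0 subrr
      mulr0.
    by rewrite big_ord_recr /= IH exprS; lra.
  have : 0 <= (2^-1) ^+ n :> R by rewrite exprn_ge0 // invr_ge0.
  lra.
have : 2 * nu * \sum_(j < n) (2^-1) ^+ j <= 2 * nu * 2.
  by rewrite ler_wpM2l // mulr_ge0.
lra.
Qed.

End Letters.
End Undone.

(* Throughout, [u] is the word before the current letter and [w] the word from
   this letter on. *)
Section GainLoss.
Context {R : realType} {X : metricType R} (o : X).
Local Notation G := (bij_isometry X).
Local Notation gp := gromov_product.
Local Notation inv := isometry_inv.
Local Notation len := (len o).
Local Notation shadowed := (shadowed o).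
Variable delta : R.
Hypothesis delta_ge0 : 0 <= delta.
Hypothesis hyp : forall x y z a : X,
  Num.min (gp x y a) (gp y z a) - delta <= gp x z a.
Variables (C1 A : R).
Hypothesis C1_ge0 : 0 <= C1.
Hypothesis A_ge0 : 0 <= A.
Implicit Types (s : G) (u v w : seq G) (a b : X).

(** What the letter adds to the length when it is never undone, by
[gp_progress], truncated at [A] in order to have exponential moments. *)
Definition letter_gain s : R :=
  Num.min (Num.max (len s - (4 * C1 + 2 * delta)) 0) A.

Lemma letter_gain_ge0 s : 0 <= letter_gain s.
Proof. by rewrite le_min A_ge0 le_max lexx orbT. Qed.

Lemma letter_gain_leA s : letter_gain s <= A.
Proof. by rewrite ge_min lexx orbT. Qed.

(** The past is read backwards from [s], as a path of the inverse walk. *)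
Definition stable u s v : bool :=
  ~~ shadowed C1 (inv s o) v && ~~ shadowed C1 (s o) (map inv (rev u)).

Fixpoint gain u w : R :=
  if w is s :: v then (stable u s v)%:R * letter_gain s + gain (rcons u s) v
    else 0.

Fixpoint loss u w : R :=
  if w is s :: v then (~~ stable u s v)%:R * letter_gain s + loss (rcons u s) v
    else 0.

Lemma gainE u w : gain u w = \sum_(s <- w) letter_gain s - loss u w.
Proof.
elim: w u => [|s v IH] u /=; first by rewrite big_nil subr0.
by rewrite IH big_cons; case: (stable u s v); rewrite /= ?mul1r ?mul0r; lra.
Qed.

Lemma loss_ge0 u w : 0 <= loss u w.
Proof.
elim: w u => [|s v IH] u //=.
by rewrite addr_ge0 // mulr_ge0 // letter_gain_ge0.
Qed.

Lemma not_shadowed a v j : ~~ shadowed C1 a v -> (j <= size v)%N ->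
  gp a (prodw (take j v) o) o <= C1.
Proof.
move=> /hasPn H jv; rewrite leNgt; apply: H.
by rewrite mem_iota add0n ltnS.
Qed.

(** The letters are examined in turn, and an unstable letter joins the prefix
[u]. At a stable letter the prefix is discarded into [u0], and what remains is
[v], to which the letter adds its gain. The discarded letters [u0] still matter
for stability only. *)
Lemma gain_le_len u0 u w : gain (u0 ++ u) w <= len (prodw (u ++ w)).
Proof.
elim: w u0 u => [|s v IH] u0 u /=; first exact: len_ge0.
have skip : gain (rcons (u0 ++ u) s) v <= len (prodw (u ++ s :: v)).
  by rewrite rcons_cat -cat_rcons; exact: IH.
have [st|_] := boolP (stable (u0 ++ u) s v); last by rewrite mul0r add0r.
have [sl|sl] := leP (len s) (4 * C1 + 2 * delta).
  have -> : letter_gain s = 0 by rewrite /letter_gain max_r ?min_l // subr_le0.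
  by rewrite mulr0 add0r.
have rest : gain (rcons (u0 ++ u) s) v <= len (prodw v).
  by have := IH (rcons (u0 ++ u) s) [::]; rewrite cats0.
case/andP: st => st1 st2.
have back : gp (prodw v o) (inv s o) o <= C1.
  by have := not_shadowed st1 (leqnn _); rewrite take_size gpC.
have front : gp (inv (prodw u) o) (s o) o <= C1.
  have := not_shadowed (j := size u) st2 _.
  rewrite size_map size_rev size_cat leq_addl => /(_ isT).
  rewrite rev_cat map_cat take_size_cat ?size_map ?size_rev //.
  by rewrite prodw_inv_rev gpC.
have long : 2 * C1 + delta < len s by move: C1_ge0 delta_ge0; lra.
have := gp_progress hyp C1_ge0 front front back long.
have -> : gp (inv (prodw u) o) (inv (prodw u) o) (s (prodw v o)) =
    len (prodw (u ++ s :: v)).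
  by rewrite gpxx dist_inv /len prodw_cat /= !isom_mulE metric_sym.
have : letter_gain s <= len s - (4 * C1 + 2 * delta).
  rewrite /letter_gain ge_min; apply/orP; left.
  by rewrite ge_max lexx subr_ge0 ltW.
by rewrite mul1r -/(len _); lra.
Qed.

Section Expectation.
Variables (th : seq (R * G)) (kap : R).
Hypothesis Hth : sublaw th.
Hypothesis shadowed_fwd : forall n a,
  ev (words th n) (fun v => (shadowed C1 a v)%:R) <= kap.
Hypothesis shadowed_bwd : forall n a,
  ev (words (inv_law th) n) (fun v => (shadowed C1 a v)%:R) <= kap.

Let mean_gain := ev th letter_gain.

(** Whether the past or the future undoes [s] is independent of [s] up to the
choice of the shadow, over which the bounds are uniform; so the loss is a small
fraction of the mean gain. *)
Lemma unstable_le i n :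
  ev (words th i) (fun u => ev th (fun s => ev (words th n) (fun v =>
    (~~ stable u s v)%:R * letter_gain s))) <= 2 * kap * mean_gain.
Proof.
have subw j : sublaw (words th j) by exact: sublaw_words.
have kap0 : 0 <= kap by apply: le_trans (shadowed_fwd 0 o); apply: ev_ge0.
apply: (@le_trans _ _ (ev (words th i) (fun u => ev th (fun s =>
    letter_gain s * kap + letter_gain s *
      (shadowed C1 (s o) (map inv (rev u)))%:R)))).
  apply: ev_le => // u; apply: ev_le => // s.
  apply: (@le_trans _ _ (ev (words th n) (fun v => letter_gain s *
      (shadowed C1 (inv s o) v)%:R + letter_gain s *
      (shadowed C1 (s o) (map inv (rev u)))%:R))).
    apply: ev_le => // v; rewrite -mulrDr mulrC ler_wpM2l ?letter_gain_ge0 //.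
    by rewrite /stable; do 2 case: shadowed; rewrite /= ?addr0 ?add0r ?lerDl.
  rewrite evD evZ lerD // ?ler_wpM2l ?letter_gain_ge0 //.
  by apply: ev_le_cst => //; rewrite mulr_ge0 ?letter_gain_ge0.
under eq_ev do rewrite evD evZr.
rewrite evD (_ : 2 * kap * mean_gain = mean_gain * kap + mean_gain * kap);
  last by lra.
have m0 : 0 <= mean_gain by apply: ev_ge0 => // s; exact: letter_gain_ge0.
apply: lerD; first by apply: ev_le_cst => //; exact: mulr_ge0.
rewrite ev_swap /mean_gain -evZr; apply: ev_le => // s.
rewrite evZ ler_wpM2l ?letter_gain_ge0 //.
apply: le_trans (shadowed_bwd i (s o)).
by rewrite ev_words_map -(ev_words_rev _ _
  (fun w => (shadowed C1 (s o) (map inv w))%:R)).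
Qed.

Lemma mean_loss_le n i : ev (words th i) (fun u => ev (words th n) (loss u)) <=
  n%:R * (2 * kap * mean_gain).
Proof.
elim: n i => [|n IH] i.
  rewrite mul0r; apply: ev_le_cst => // [|u]; first exact: sublaw_words.
  by rewrite ev_words0.
under eq_ev do rewrite ev_wordsS.
under eq_ev do under eq_ev do rewrite /= evD.
under eq_ev do rewrite evD.
rewrite evD -natr1 mulrDl mul1r addrC lerD ?unstable_le //.
by rewrite -(ev_words_rcons th i (fun u => ev (words th n) (loss u))).
Qed.

Lemma exp_le_quadratic (x : R) : 0 <= x -> expR (- x) <= 1 - x + x ^+ 2.
Proof.
move=> x0; rewrite expRN; have e1 := expR_ge1Dx x.
have x1 : 0 < 1 + x by lra.
apply: (@le_trans _ _ (1 + x)^-1).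
  by rewrite lef_pV2 ?posrE // (lt_le_trans x1).
rewrite -(ler_pM2r x1) mulVf ?gt_eqF //.
have : 0 <= x ^+ 3 by rewrite exprn_ge0.
by rewrite (_ : (1 - x + x ^+ 2) * (1 + x) = 1 + x ^+ 3); [lra|ring].
Qed.

Lemma chernoff n (l c : R) : 0 <= l ->
  ev (words th n) (fun w => (\sum_(s <- w) letter_gain s <= c)%R%:R) <=
  expR (l * c - n%:R * (l * mean_gain - l ^+ 2 * A ^+ 2)).
Proof.
move=> l0.
apply: (@le_trans _ _ (ev (words th n) (fun w =>
    expR (l * c) * \prod_(s <- w) expR (- (l * letter_gain s))))).
  apply: ev_le => [|w]; first exact: sublaw_words.
  apply: (le_trans (indic_le_exp _ _ l0)); rewrite ler_wpM2l ?expR_ge0 //.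
  rewrite mulNr mulr_sumr -sumrN.
  elim: w => [|s w IH]; first by rewrite !big_nil expR0.
  by rewrite !big_cons expRD ler_wpM2l ?expR_ge0.
rewrite evZ ev_words_prod expRD ler_wpM2l ?expR_ge0 //.
rewrite -mulrN expRM_natl lerXn2r ?nnegrE ?expR_ge0 //.
  by apply: ev_ge0 => // s; exact: expR_ge0.
apply: le_trans (expR_ge1Dx _).
apply: (@le_trans _ _ (ev th (fun s => 1 - l * letter_gain s + l ^+ 2 * A ^+
  2))).
  apply: ev_le => // s.
  have g0 := letter_gain_ge0 s; have gA := letter_gain_leA s.
  apply: (le_trans (exp_le_quadratic (mulr_ge0 l0 g0))).
  by rewrite lerD2l exprMn ler_wpM2l ?sqr_ge0 // lerXn2r ?nnegrE.
rewrite evD evB evZ [ev th (fun=> _ * _)]ev_cst -/mean_gain.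
have [_ m1] := Hth.
have : l ^+ 2 * A ^+ 2 * ev th (fun=> 1) <= l ^+ 2 * A ^+ 2.
  by rewrite ler_piMr // mulr_ge0 ?sqr_ge0.
by lra.
Qed.

(** The length is at least the total gain of all the letters minus the gain of
those that are undone. The former is concentrated, as a sum of independent
bounded variables; the latter is small in mean. *)
Lemma short_product_le n (t S l : R) : 0 < t -> 0 < S -> 0 <= l -> (0 < n)%N ->
  mean_gain <= S -> (1 - t / 2) * S <= mean_gain ->
  ev (words th n) (fun w => (len (prodw w) <= n%:R * ((1 - 2 * t) * S))%R%:R) <=
  expR (- n%:R * (l * (t / 2 * S) - l ^+ 2 * A ^+ 2)) + 2 * kap / t.
Proof.
move=> t0 S0 l0 n0 mS Sm; have n0' : 0 < n%:R :> R by rewrite ltr0n.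
have thr0 : 0 < n%:R * (t * S) by rewrite !mulr_gt0.
apply: (@le_trans _ _ (ev (words th n) (fun w =>
    (\sum_(s <- w) letter_gain s <= n%:R * ((1 - t) * S))%R%:R +
    (n%:R * (t * S) <= loss [::] w)%R%:R))).
  apply: ev_le => [|w]; first exact: sublaw_words.
  have := gain_le_len [::] [::] w; rewrite /= gainE.
  case: (leP (len (prodw w)) (n%:R * ((1 - 2 * t) * S))) => H1 H2; last first.
    by rewrite addr_ge0.
  case: (leP (\sum_(s <- w) letter_gain s) (n%:R * ((1 - t) * S))) => H3.
    by rewrite lerDl.
  by case: (leP (n%:R * (t * S)) (loss [::] w)) => H4; rewrite ?add0r //; lra.
rewrite evD; apply: lerD.
  apply: (le_trans (chernoff n _ l0)); rewrite ler_expR.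
  have : 0 <= n%:R * (l * (mean_gain - (1 - t / 2) * S)).
    by rewrite !mulr_ge0 ?(ltW n0') // subr_ge0.
  by lra.
apply: (le_trans (ev_markov _ thr0 (loss_ge0 [::]))); first exact: sublaw_words.
rewrite ler_pdivrMr //.
have := mean_loss_le n 0; rewrite ev_words0 => /le_trans; apply.
have kap0 : 0 <= kap by apply: le_trans (shadowed_fwd 0 o); apply: ev_ge0;
  first exact: sublaw_words.
rewrite (_ : 2 * kap / t * (n%:R * (t * S)) = n%:R * (2 * kap * S)); last first.
  by field; rewrite gt_eqF.
by rewrite ler_wpM2l ?(ltW n0') // ler_wpM2l // mulr_ge0.
Qed.

End Expectation.

End GainLoss.

(** * Law of large numbers and exponential decay *)
Section Escape.
Context {R : realType} {X : metricType R} (o : X).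
Local Notation G := (bij_isometry X).
Local Notation gp := gromov_product.
Local Notation inv := isometry_inv.
Local Notation len := (len o).
Variable delta : R.
Hypothesis delta_ge0 : 0 <= delta.
Hypothesis hyp : forall x y z a : X,
  Num.min (gp x y a) (gp y z a) - delta <= gp x z a.
Variable th : nat -> seq (R * G).
Hypothesis Hth : exhausting th.
Hypothesis sch : schottky o th.
Hypothesis sch_inv : schottky o (inv_law \o th).
Implicit Types (s : G) (a b : X).

Let Hsub K : sublaw (th K). Proof. by case: Hth. Qed.
Let Hpow K n : sublaw (pow_law (th K) n). Proof. exact: sublaw_pow. Qed.

Lemma pow_spread (eta : R) : 0 < eta -> exists2 C, 0 <= C & exists n0,
  forall K n,
  (n0 <= n)%N -> spread o (pow_law (th K) n) C eta.
Proof.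
move=> eta0.
have [C1 [n1 H1]] := schottky_unconcentrated Hth sch (lexx 0) eta0.
have [C2 [n2 H2]] := schottky_unconcentrated (exhausting_inv Hth) sch_inv
  (lexx 0) eta0.
exists (Num.max 0 (Num.max C1 C2)); first by rewrite le_max lexx.
have mono (C C' x : R) : C' <= C -> (C < x)%R%:R <= (C' < x)%R%:R :> R.
  by move=> CC; case: (ltP C x) => // Cx; rewrite (le_lt_trans CC Cx).
exists (maxn n1 n2) => K n; rewrite geq_max => /andP[nn1 nn2]; split=> a.
  apply: le_trans (H1 K n a nn1); apply: ev_le => // s.
  rewrite /shadow; case: (leP (mdist _ _) 0) => _; rewrite ?orbT ?orbF.
    by case: (_ < _).
  by apply: mono; rewrite !le_max lexx orbT.
apply: le_trans (H2 K n a nn2); rewrite /= -inv_pow [leRHS]ev_map;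
  apply: ev_le => // s.
rewrite /shadow; case: (leP (mdist _ _) 0) => _; rewrite ?orbT ?orbF.
  by case: (_ < _).
by apply: mono; rewrite !le_max lexx !orbT.
Qed.

Lemma small_ball (L eta : R) : 0 <= L -> 0 < eta -> exists n0, forall K n,
  (n0 <= n)%N -> ev (pow_law (th K) n) (fun s => (len s <= L)%R%:R) <= eta.
Proof.
move=> L0 eta0; have [C [n0 H]] := schottky_unconcentrated Hth sch L0 eta0.
exists n0 => K n nn; apply: le_trans (H K n o nn); apply: ev_le => [|s];
  first exact: Hpow.
by rewrite /shadow /len; case: (leP (mdist _ _) L) => //; rewrite orbT.
Qed.

Lemma laplace_small_ball th0 (L l : R) : sublaw th0 -> 0 <= l ->
  ev th0 (fun s => expR (- l * len s)) <=
  ev th0 (fun s => (len s <= L)%R%:R) + expR (- l * L).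
Proof.
move=> H0 l0; apply: (@le_trans _ _ (ev th0 (fun s => (len s <= L)%R%:R + expR
  (- l * L)))).
  apply: ev_le => // s; case: (leP (len s) L) => sL.
    rewrite -[leLHS]addr0 lerD ?expR_ge0 //.
    by rewrite -[leRHS]expR0 ler_expR mulNr oppr_le0 mulr_ge0 ?len_ge0.
  by rewrite add0r ler_expR !mulNr lerN2 ler_wpM2l // ltW.
rewrite evD lerD2l; apply: ev_le_cst => //; exact: expR_ge0.
Qed.

(** All that will be kept of the escape rate, in a form that also makes sense
when it is infinite. *)
Definition drift (r : R) : Prop := forall m0, exists2 m, (m0 <= m)%N &
  exists K, r * m%:R <= ev (pow_law (th K) m) len.

(** The recursion of [laplace_decay] closes with [T = 4] and [B = 2] as soon as
the blocks are long enough to be spread and rarely short. *)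
Lemma rarely_shadowed nu : 0 < nu -> exists2 C1, 0 <= C1 & exists m0,
  forall K m, (m0 <= m)%N -> forall n a,
    ev (words (pow_law (th K) m) n) (fun v => (shadowed o C1 a v)%:R) <= 32 * nu
      /\
    ev (words (inv_law (pow_law (th K) m)) n) (fun v => (shadowed o C1 a v)%:R)
      <= 32 * nu.
Proof.
(* The recursion closes because [16 nu^2 + 1/2 + 512 nu^2 <= 1]. *)
move=> nu0'; pose nu' := Num.min nu (50^-1).
suff [C1 C10 [m0 Hm0]] : exists2 C1, 0 <= C1 & exists m0,
  forall K m, (m0 <= m)%N -> forall n a,
    ev (words (pow_law (th K) m) n) (fun v => (shadowed o C1 a v)%:R) <= 32 *
      nu' /\
    ev (words (inv_law (pow_law (th K) m)) n) (fun v => (shadowed o C1 a v)%:R)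
      <= 32 * nu'.
  exists C1 => //; exists m0 => K m mm n a; have [H1 H2] := Hm0 K m mm n a.
  by split; [apply: le_trans H1 _|apply: le_trans H2 _];
    rewrite ler_wpM2l // ge_min lexx.
have : 0 < nu' by rewrite lt_min nu0' invr_gt0 ltr0n.
have : nu' <= 50^-1 by rewrite ge_min lexx orbT.
move: nu' => {nu0'}{}nu nu1 nu0.
have eta0 : 0 < nu ^+ 2 by rewrite exprn_gt0.
have eta1 : nu ^+ 2 <= (50^-1) ^+ 2 by rewrite lerXn2r ?nnegrE ?(ltW nu0).
have [C C0 [n1 Hsp]] := pow_spread eta0.
have [l' [C1 [l'0 CC1 l'd l'C C1C]]] := decay_constants delta_ge0 C0.
pose E := expR (l' * (4 * C1 + 2 * delta)).
have E1 : 1 <= E.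
  rewrite -[leLHS]expR0 ler_expR mulr_ge0 ?(ltW l'0) // addr_ge0 ?mulr_ge0 //.
  exact: le_trans CC1.
have E0 : 0 < E by exact: expR_gt0.
(* Displacements larger than [L] contribute at most [(32 * E)^-1] to the Laplace
   transform of a block, and small ones as much. *)
pose L := ln (32 * E) / l'.
have L0 : 0 <= L by rewrite divr_ge0 ?(ltW l'0) // ln_ge0 //; lra.
have x0 : 0 < (32 * E)^-1 by rewrite invr_gt0 mulr_gt0.
have [n2 Hball] := small_ball L0 x0.
exists C1; first exact: le_trans CC1.
exists (maxn 1 (maxn n1 n2)) => K m; rewrite !geq_max => /and3P[m1 mn1 mn2] n a.
have sp := Hsp K m mn1.
have EL : expR (- l' * L) = (32 * E)^-1.
  rewrite mulNr /L mulrC divfK ?gt_eqF // expRN lnK // posrE mulr_gt0 //.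
have sg : ev (pow_law (th K) m) (fun s => expR (- l' * len s)) <= 16^-1 * E^-1.
  apply: le_trans (laplace_small_ball L (Hpow K m) (ltW l'0)) _.
  rewrite EL; have := Hball K m mn2; rewrite invfM; lra.
have HB : 1 + (2 * nu ^+ 2 + E * (16^-1 * E^-1)) * 4 * 2 +
    (4 * expR (l' * C) * nu ^+ 2) * 4 ^+ 2 * 2 ^+ 2 <= 2.
  have -> : E * (16^-1 * E^-1) = 16^-1 by rewrite mulrCA divff ?mulr1 // gt_eqF.
  have : expR (l' * C) * nu ^+ 2 <= 2 * nu ^+ 2 by rewrite ler_wpM2r // ltW.
  by rewrite -!natrX; lra.
have ret th0 : sublaw th0 -> spread o th0 C (nu ^+ 2) ->
    ev th0 (fun s => expR (- l' * len s)) <= 16^-1 * E^-1 ->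
    forall n a b, laplace o th0 l' n a b * 4 ^+ n <= 2.
  move=> H0 sp0 sg0 n' a' b'.
  refine (laplace_decay delta_ge0 hyp H0 C0 l'0 l'd C1C (ltW l'0) (lexx l') sp0
    sg0
    (ler0n _ 4) (ler0n _ 2) HB n' a' b').
have endp k a' : (0 < k)%N -> ev (words (pow_law (th K) m) k)
    (fun w => (C < gp a' (prodw w o) o)%R%:R) <= nu ^+ 2.
  move=> k0; rewrite (ev_pow_words (th K) m k
    (fun z => (C < gp a' (z o) o)%R%:R)).
  by have [-> //] := Hsp K (m * k)%N (leq_trans mn1 (leq_pmulr _ k0)).
have endp' k a' : (0 < k)%N -> ev (words (inv_law (pow_law (th K) m)) k)
    (fun w => (C < gp a' (prodw w o) o)%R%:R) <= nu ^+ 2.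
  move=> k0; rewrite (ev_inv_words _ k (fun z => (C < gp a' (z o) o)%R%:R)).
  rewrite (ev_pow_words (th K) m k (fun z => (C < gp a' (inv z o) o)%R%:R)).
  by have [_ -> //] := Hsp K (m * k)%N (leq_trans mn1 (leq_pmulr _ k0)).
have sg' : ev (inv_law (pow_law (th K) m)) (fun s => expR (- l' * len s)) <=
  16^-1 * E^-1.
  by rewrite ev_map; under eq_ev do rewrite len_inv.
have Hinv : sublaw (inv_law (pow_law (th K) m)) by exact: sublaw_map.
split.
  apply: (shadowed_le delta_ge0 hyp (Hpow K m) C0 l'0 l'd l'C C1C (ltW nu0)
    endp).
  exact: (ret _ Hinv (spread_inv sp) sg').
apply: (shadowed_le delta_ge0 hyp Hinv C0 l'0 l'd l'C C1C (ltW nu0) endp').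
by rewrite inv_lawK; exact: (ret _ (Hpow K m) sp sg).
Qed.

Lemma nat_above (x : R) : exists m, x <= m%:R.
Proof. by exists (Num.truncn x).+1; exact/ltW/truncnS_gt. Qed.

(** Some blocks of [m] steps have mean length at least [r' m], and a long
product of such blocks has almost the length [r' m] per block, since few are
undone. The truncation at [A] and the mean gain [S] are fixed before the number
of blocks, which gives bounds that are uniform in [K]. *)
Lemma weak_law (r r' e : R) m0 : 0 <= r -> r < r' -> drift r' -> 0 < e ->
  exists2 M, (m0 <= M)%N & forall K,
    ev (pow_law (th K) M) (fun s => (len s <= r * M%:R)%R%:R) <= e.
Proof.
move=> r0 rr' dr e0.
pose r2 := (r + r') / 2; have r2_gt : r < r2 by rewrite /r2; lra.
have r2_lt : r2 < r' by rewrite /r2; lra.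
have r2_gt0 : 0 < r2 by exact: le_lt_trans r2_gt.
pose t := (r2 - r) / (2 * r2).
have t0 : 0 < t by apply: divr_gt0; [rewrite subr_gt0|exact: mulr_gt0].
have tE : (1 - 2 * t) * r2 = r by rewrite /t; field; rewrite gt_eqF.
pose nu := e * t / 128.
have nu0 : 0 < nu by rewrite divr_gt0 // mulr_gt0.
have [C1 C10 [m1 Hsh]] := rarely_shadowed nu0.
pose c := 4 * C1 + 2 * delta.
have c0 : 0 <= c by rewrite addr_ge0 ?mulr_ge0.
have [m2 Hm2] := nat_above (c / (r' - r2)).
have [m mm [K1 HK1]] := dr (maxn 1 (maxn m0 (maxn m1 m2))).
move: mm; rewrite !geq_max => /and4P[m_gt0 mm0 mm1 mm2].
have {}Hm2 : c <= (r' - r2) * m%:R.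
  rewrite mulrC -ler_pdivrMr ?subr_gt0 //; apply: (le_trans Hm2).
  by rewrite ler_nat.
(* [A] exceeds the lengths of the atoms of the truncation [K1]: for that
   truncation, the gain is the length up to the constant [c]. *)
have [A0 A0_ge0 HA0] := law_bounded (pow_law (th K1) m) len.
pose A := A0 + 1; have A_gt0 : 0 < A by rewrite /A; lra.
pose g := letter_gain o delta C1 A.
pose V : set R := [set ev (pow_law (th K) m) g | K in setT].
have gA s : g s <= A by exact: letter_gain_leA.
have g0 s : 0 <= g s by apply: letter_gain_ge0; exact: ltW.
have VA : ubound V A.
  by move=> _ [K _ <-]; apply: ev_le_cst => //; exact: ltW.
have hV : has_sup V by split; [exists (ev (pow_law (th K1) m) g), K1|exists A].
pose S := sup V.
have VS K : ev (pow_law (th K) m) g <= S.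
  by apply: ub_le_sup; [exists A|exists K].
have S_ge : r2 * m%:R <= S.
  apply: le_trans (VS K1).
  apply: (@le_trans _ _ (ev (pow_law (th K1) m) (fun s => len s - c))).
    rewrite evB ev_cst; have : c * ev (pow_law (th K1) m) (fun=> 1) <= c.
      by rewrite ler_piMr //; case: (Hpow K1 m).
    lra.
  rewrite (HA0 g (fun s => Num.max (len s - c) 0)); last first.
    move=> s sA; rewrite /g /letter_gain min_l // ge_max (ltW A_gt0) andbT.
    by rewrite /A -/c; lra.
  by apply: ev_le => // s; rewrite le_max lexx.
have S0 : 0 < S by apply: lt_le_trans S_ge; rewrite mulr_gt0 ?ltr0n.
(* From [K2] on, mean gains are within [t / 2 * S] of their supremum. *)
have [_ [K2 _ <-] HK2] := sup_adherent (mulr_gt0 (divr_gt0 t0 (ltr0n _ 2)) S0)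
  hV.
rewrite -/S in HK2.
(* A quarter of [t * S / A ^+ 2] leaves half of the linear term of [q]. *)
pose l := t * S / (4 * A ^+ 2).
have l0 : 0 < l.
  by apply: divr_gt0; apply: mulr_gt0 => //; exact: exprn_gt0.
pose q := l * (t / 2 * S) - l ^+ 2 * A ^+ 2.
have q0 : 0 < q.
  rewrite (_ : q = l * (t * S / 4)); first by
    apply: mulr_gt0 => //; apply: divr_gt0 => //; exact: mulr_gt0.
  by rewrite /q /l; field; rewrite gt_eqF.
have [N HN] := nat_above (2 / (e * q)).
pose n := N.+1; have nq : 2 / e <= n%:R * q.
  rewrite -ler_pdivrMr // -mulrA -invfM; apply: (le_trans HN).
  by rewrite ler_nat.
exists (m * n)%N; first by rewrite (leq_trans mm0) // leq_pmulr.
move=> K; apply: le_trans (ev_pow_mono Hth _ (leq_maxl K K2) _) _ => //.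
set K' := maxn K K2.
rewrite -(ev_pow_words (th K') m n (fun s => (len s <= r * (m * n)%:R)%R%:R)).
have fwd k a := (Hsh K' m mm1 k a).1; have bwd k a := (Hsh K' m mm1 k a).2.
have mean : (1 - t / 2) * S <= ev (pow_law (th K') m) g.
  apply: le_trans (ev_pow_mono Hth m (leq_maxr K K2) g0).
  by apply: ltW; apply: le_lt_trans HK2; lra.
have := short_product_le delta_ge0 hyp C10 (ltW A_gt0) (Hpow K' m) fwd bwd
  t0 S0 (ltW l0) (ltn0Sn N) (VS K') mean.
rewrite -/n -/q => H; apply: (@le_trans _ _ (e / 2 + e / 2)); last by lra.
apply: (@le_trans _ _ (expR (- n%:R * q) + 2 * (32 * nu) / t)); last first.
  apply: lerD; last by rewrite /nu le_eqVlt; apply/orP; left; apply/eqP; field;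
    rewrite gt_eqF.
  have nq0 : 0 < n%:R * q by rewrite mulr_gt0 ?ltr0n.
  rewrite mulNr expRN -[leRHS]invrK lef_pV2 ?posrE ?expR_gt0 ?invr_gt0 ?divr_gt0
    //.
  rewrite invf_div; apply: (le_trans nq).
  by apply: le_trans (expR_ge1Dx _); rewrite lerDr.
apply: le_trans H; apply: ev_le => [|w]; first by apply: sublaw_words.
case: (leP (len (prodw w)) (r * (m * n)%:R)) => // H1.
have H2 : r * (m * n)%:R <= n%:R * ((1 - 2 * t) * S).
  have t1 : 0 <= 1 - 2 * t by rewrite -(pmulr_lge0 _ r2_gt0) tE.
  rewrite natrM mulrA mulrC ler_wpM2l // -tE -mulrA ler_wpM2l //.
by rewrite (le_trans H1 H2).
Qed.

(** The recursion is applied to blocks of [M] steps with [l = 1 / M], so that a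
displacement of [r2 * M] contributes [expR (- r2)]. The errors, measured by [d],
are the probability that a block is short, the factor [expR (l * c)], which
tends to 1 as [M] grows, and the [eta] of bad positions. The target [T = expR
r1] per block is below [expR r2], hence the linear coefficient stays below 1. *)
Lemma exponential_bound (r r' : R) : 0 <= r -> r < r' -> drift r' ->
  exists2 kap, 0 < kap & exists B : R, forall K n,
    ev (pow_law (th K) n) (fun s => (len s <= r * n%:R)%R%:R) <=
      B * expR (- kap * n%:R).
Proof.
move=> r0 rr' dr.
pose r2 := (r + r') / 2; have r2_gt : r < r2 by rewrite /r2; lra.
have r2_lt : r2 < r' by rewrite /r2; lra.
have r2_ge0 : 0 <= r2 by exact: le_trans (ltW r2_gt).
pose r1 := (r + r2) / 2; have r1_gt : r < r1 by rewrite /r1; lra.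
have r1_lt : r1 < r2 by rewrite /r1; lra.
pose T := expR r1; have T0 : 0 < T by exact: expR_gt0.
pose x := expR (- r2) * T.
have x0 : 0 < x by rewrite mulr_gt0 ?expR_gt0.
have x1 : x < 1 by rewrite /x -expRD -expR0 ltr_expR; lra.
pose y := (1 + x) / 2; pose B := 2 / (1 - y).
have y1 : 0 < 1 - y by rewrite /y; lra.
have B0 : 0 < B by rewrite divr_gt0.
have BE : B * (1 - y) = 2 by rewrite divfK // gt_eqF.
pose d := (1 - x) / 6; have d0 : 0 < d by rewrite /d; lra.
have yE : y = x + 3 * d by rewrite /y /d; lra.
have TB0 : 0 < T ^+ 2 * B ^+ 2 by rewrite mulr_gt0 ?exprn_gt0.
pose eta := Num.min (d / (2 * T)) (8 * (T ^+ 2 * B ^+ 2))^-1.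
have eta0 : 0 < eta.
  by rewrite lt_min invr_gt0 (mulr_gt0 (ltr0n _ 8) TB0) andbT divr_gt0 //
    mulr_gt0.
have eta1 : 2 * eta * T <= d.
  have : eta <= d / (2 * T) by rewrite ge_min lexx.
  by rewrite ler_pdivlMr; [lra|exact: mulr_gt0].
have eta2 : 8 * eta * (T ^+ 2 * B ^+ 2) <= 1.
  have : eta <= (8 * (T ^+ 2 * B ^+ 2))^-1 by rewrite ge_min lexx orbT.
  have T8 : 0 < 8 * (T ^+ 2 * B ^+ 2) by rewrite mulr_gt0.
  by move=> /(ler_wpM2r (ltW T8)); rewrite mulVf ?gt_eqF //; lra.
have [C C0 [n1 Hsp]] := pow_spread eta0.
have [l' [C1 [l'0 CC1 l'd l'C C1C]]] := decay_constants delta_ge0 C0.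
pose c := 4 * C1 + 2 * delta.
have c0 : 0 <= c by rewrite /c; move: delta_ge0; lra.
pose e := d / (4 * T); have e0 : 0 < e by rewrite divr_gt0 // mulr_gt0.
have d1 : 0 < ln (1 + d) by rewrite ln_gt0 // ltrDl.
have [m1 Hm1] := nat_above (c / ln (1 + d)).
have [m2 Hm2] := nat_above (l'^-1).
have [M] := weak_law (maxn 1 (maxn n1 (maxn m1 m2))) r2_ge0 r2_lt dr e0.
rewrite !geq_max => /and4P[M0 Mn1 Mm1 Mm2] HM.
have MR : 0 < M%:R :> R by rewrite ltr0n.
pose l := M%:R^-1 : R; have l0 : 0 < l by rewrite invr_gt0.
have ll' : l <= l'.
  rewrite -[leRHS]invrK lef_pV2 ?posrE ?invr_gt0 //.
  by apply: (le_trans Hm2); rewrite ler_nat.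
have lc : expR (l * c) <= 1 + d.
  rewrite -[leRHS]lnK ?posrE; last by rewrite addr_gt0.
  rewrite ler_expR mulrC ler_pdivrMr // mulrC -ler_pdivrMr //.
  by apply: (le_trans Hm1); rewrite ler_nat.
have decay K k a b : laplace o (pow_law (th K) M) l k a b * T ^+ k <= B.
  apply: (laplace_decay delta_ge0 hyp (Hpow K M) C0 l'0 l'd C1C (ltW l0) ll'
    (Hsp K M Mn1) (sg := e + expR (- r2)) _ (ltW T0) (ltW B0)).
    apply: le_trans (laplace_small_ball (r2 * M%:R) (Hpow K M) (ltW l0)) _.
    apply: lerD; first exact: HM.
    by rewrite ler_expR mulNr mulrCA /l mulVf ?mulr1 // gt_eqF.
  have lce : expR (l * c) * (e + expR (- r2)) * T <= 2 * d + x.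
    rewrite -mulrA mulrDl -/x.
    have -> : e * T = d / 4 by rewrite /e; field; rewrite gt_eqF.
    apply: (@le_trans _ _ ((1 + d) * (d / 4 + x))).
      by rewrite ler_wpM2r // addr_ge0 ?(ltW x0) // divr_ge0 // ltW.
    have : d * x <= d * 1 by rewrite ler_wpM2l ?(ltW d0) ?(ltW x1).
    have : d * d <= d * 1 by rewrite ler_wpM2l ?(ltW d0) // /d; lra.
    by move: d0; lra.
  have first : (2 * eta + expR (l * c) * (e + expR (- r2))) * T <= y.
    by rewrite mulrDl yE; lra.
  have second : 4 * expR (l' * C) * eta * T ^+ 2 * B ^+ 2 <= 1.
    apply: le_trans eta2; rewrite -[leLHS]mulrA ler_wpM2r ?(ltW TB0) //.
    by rewrite ler_wpM2r ?(ltW eta0) //; lra.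
  have : (2 * eta + expR (l * c) * (e + expR (- r2))) * T * B <= y * B.
    by rewrite ler_wpM2r // ltW.
  by move: second BE; rewrite -/c; lra.
pose kap := (r1 - r) / M%:R.
exists kap; first by rewrite divr_gt0 // subr_gt0.
exists (B * expR r1) => K n.
pose k := (n %/ M)%N; pose i := (n %% M)%N.
have nE : n = (i + M * k)%N by rewrite /i /k mulnC addnC -divn_eq.
have kn : n%:R / M%:R <= k%:R + 1 :> R.
  by rewrite ler_pdivrMr // natr1 -natrM ler_nat ltnW // ltn_ceil.
have cst_ge0 : 0 <= B * expR r1 * expR (- kap * n%:R).
  by rewrite mulr_ge0 ?expR_ge0 // mulr_ge0 ?expR_ge0 // ltW.
rewrite {1}nE ev_powD; apply: ev_le_cst => // s.
rewrite -(ev_pow_words (th K) M k (fun z => (len (s * z)%g <= r * n%:R)%R%:R)).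
(* The [n %% M] steps that do not fill a block come first; they are absorbed by
   the start point [a], over which the decay is uniform. *)
pose a := inv s o.
apply: (@le_trans _ _ (expR (l * (r * n%:R)) * laplace o (pow_law (th K) M) l k
  a a)).
  rewrite /laplace -evZ; apply: ev_le => [|w]; first by apply: sublaw_words.
  have -> : gp a a (prodw w o) = len (s * prodw w)%g.
    by rewrite gpxx /a dist_inv metric_sym.
  exact: indic_le_exp (ltW l0).
have Lk : laplace o (pow_law (th K) M) l k a a <= B * expR (- r1 * k%:R).
  have := decay K k a a; rewrite -ler_pdivlMr ?exprn_gt0 //.
  by rewrite mulNr expRN (mulrC r1) expRM_natl.
apply: (le_trans (ler_wpM2l (expR_ge0 _) Lk)).
rewrite mulrCA -[leRHS]mulrA ler_wpM2l ?(ltW B0) // -!expRD ler_expR.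
have r1_0 : 0 <= r1 by rewrite /r1; lra.
have := ler_wpM2l r1_0 kn.
rewrite /kap /l; have -> : M%:R^-1 * (r * n%:R) = r * (n%:R / M%:R) by ring.
have -> : - ((r1 - r) / M%:R) * n%:R = (r - r1) * (n%:R / M%:R) by ring.
by lra.
Qed.

Lemma short_product_power (r : R) K n j :
  ev (pow_law (th K) n) (fun s => (len s <= r * n%:R)%R%:R) ^+ j <=
  ev (pow_law (th K) (n * j)) (fun s => (len s <= r * (n * j)%:R)%R%:R).
Proof.
rewrite -ev_words_prod -(ev_pow_words (th K) n j
  (fun s => (len s <= r * (n * j)%:R)%R%:R)).
apply: ev_words_le => // w wj.
have prod_le v : \prod_(s <- v) (len s <= r * n%:R)%R%:R <=
    (len (prodw v) <= r * (n * size v)%:R)%R%:R :> R.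
  elim: v => [|s v IH]; first by rewrite big_nil muln0 mulr0 len1 lexx.
  rewrite big_cons; case: (leP (len s) (r * n%:R)) => H1; last first.
    by rewrite mul0r.
  rewrite mul1r (le_trans IH) //; case: (leP (len (prodw v)) _) => // H2.
  rewrite (le_trans (lenM_le o s (prodw v))) // [size _]/= mulnS natrD mulrDr.
  exact: lerD.
by rewrite -wj.
Qed.

(** The probabilities are supermultiplicative by [short_product_power]; if one
of them exceeded the exponential, its powers would exceed any multiple of it. *)
Lemma sharp_exponential_bound (r r' : R) : 0 <= r -> r < r' -> drift r' ->
  exists2 kap, 0 < kap & forall K n,
    ev (pow_law (th K) n) (fun s => (len s <= r * n%:R)%R%:R) <= expR
      (- kap * n%:R).
Proof.
move=> r0 rr' dr; have [kap kap0 [B HB]] := exponential_bound r0 rr' dr.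
exists kap => // K n; set p := ev _ _.
have p0 : 0 <= p by apply: ev_ge0.
rewrite mulNr expRN -[leRHS]mul1r ler_pdivlMr ?expR_gt0 //.
set z := p * _; have z0 : 0 <= z by rewrite mulr_ge0 ?expR_ge0.
rewrite leNgt; apply/negP => z1.
have zB j : z ^+ j <= B.
  rewrite exprMn -expRM_natl; apply: le_trans
    (ler_wpM2r (expR_ge0 _) (short_product_power r K n j)) _.
  apply: le_trans (ler_wpM2r (expR_ge0 _) (HB K (n * j)%N)) _.
  rewrite -mulrA -expRD natrM (_ : _ + _ = 0); last by ring.
  by rewrite expR0 mulr1.
have bern j : 1 + j%:R * (z - 1) <= z ^+ j.
  by rewrite -{2}(subrKC 1 z); apply: bernoulli_le; lra.
have [j Hj] := nat_above (B / (z - 1)).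
have zz : 0 < z - 1 by lra.
rewrite ler_pdivrMr // in Hj.
by have := bern j; have := zB j; lra.
Qed.

End Escape.

(** * From finite laws to the random walk *)
Section Atoms.
Context {R : realType} {X : metricType R} (o : X).
Local Notation G := (bij_isometry X).
Local Notation len := (len o).
Variable mu : probability G R.
Variable C : set G.
Hypothesis mu_C : mu (~` C) = 0%E.
Variable code : G -> nat.
Hypothesis code_inj : {in C &, injective code}.

(** Given an injection of the countable set [C] into the integers, every cell is
an atom or empty. *)
Definition cell i : set G := [set h | C h /\ code h = i].
Definition cell_elt i : G := xget 1%g (cell i).
Definition weight i : R := fine (mu (cell i)).
Definition atom_law K : seq (R * G) := [seq (weight i, cell_elt i) | i <-
  index_iota 0 K].

Lemma measurable_isometries (A : set G) : measurable A.
Proof. by []. Qed.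

Lemma cell_eltP i h : cell i h -> h = cell_elt i.
Proof.
move=> Hh; rewrite /cell_elt; case: xgetP => [g -> [Cg cg]|/(_ h)//].
by case: Hh => Ch ch; apply: code_inj; rewrite ?inE // ch cg.
Qed.

Lemma weightE i : (weight i)%:E = mu (cell i).
Proof. by rewrite fineK // fin_num_measure. Qed.

Lemma weight_ge0 i : 0 <= weight i.
Proof. by rewrite fine_ge0. Qed.

Lemma ev_atom_law K f : ev (atom_law K) f = \sum_(i < K) weight i * f
  (cell_elt i).
Proof. by rewrite /ev big_map big_mkord. Qed.

Lemma trivIset_cell : trivIset setT cell.
Proof. by move=> i j _ _ [h [[_ <-] [_ <-]]]. Qed.

Lemma atom_law_mass K : (ev (atom_law K) (fun=> 1))%:E =
  mu (\big[setU/set0]_(i < K) cell i).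
Proof.
rewrite ev_atom_law -sumEFin measure_bigsetU.
- by apply: eq_bigr => i _; rewrite mulr1 weightE.
- by [].
- exact: trivIset_cell.
Qed.

Lemma mu_C1 : mu C = 1%E.
Proof.
by rewrite -(setCK C) probability_setC ?mu_C ?sube0 //;
  exact: measurable_isometries.
Qed.

Lemma exhausting_atom_law : exhausting atom_law.
Proof.
split=> [K|K K' f KK' f0|e e0].
- split; last first.
    by rewrite -lee_fin atom_law_mass; exact: probability_le1.
  by rewrite all_map; apply/allP => i _ /=; exact: weight_ge0.
- rewrite !ev_atom_law -!(big_mkord xpredT
  (fun i => weight i * f (cell_elt i))).
  rewrite [leRHS](big_cat_nat (n := K)) //= lerDl.
  by apply: sumr_ge0 => i _; rewrite mulr_ge0 ?weight_ge0.
have CE : \bigcup_i cell i = C.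
  by apply/seteqP; split=> [h [i _ []]//|h Ch]; exists (code h).
have lim : (fun K => (ev (atom_law K) (fun=> 1))%:E) @ \oo --> 1%:E.
  rewrite -mu_C1 -CE.
  have := @measure_semi_sigma_additive _ _ _ mu cell
    (fun _ => measurable_isometries _)
    trivIset_cell (measurable_isometries _).
  apply: cvg_trans; apply: near_eq_cvg; near=> K.
  rewrite ev_atom_law -sumEFin big_mkord.
  by apply: eq_bigr => i _; rewrite mulr1 weightE.
have /fine_cvgP[_ /cvgrPdist_le/(_ e e0)[K _ HK]] := lim.
exists K; have /= := HK K (leqnn K).
by rewrite ler_distl => /andP[]; lra.
Unshelve. all: by end_near. Qed.

Lemma charged_atom h : atoms mu h -> charged atom_law 1 h.
Proof.
rewrite /atoms /= => mu_h.
have Ch : C h.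
  apply: contrapT => nCh; have : (mu [set h] <= mu (~` C))%E.
    by apply: le_measure; rewrite ?inE // => _ ->.
  by rewrite mu_C leNgt mu_h.
have cellE : cell (code h) = [set h].
  apply/seteqP; split=> [g [Cg cg]|_ ->//].
  by apply: code_inj; rewrite ?inE.
exists (weight (code h)).
  by rewrite -lte_fin weightE cellE.
exists (code h).+1 => K f hK f0.
rewrite ev_pow ev_words1; under eq_ev do rewrite /= mulg1.
rewrite ev_atom_law (bigD1 (Ordinal hK)) //=.
rewrite -(@cell_eltP (code h) h) ?cellE // lerDl.
by apply: sumr_ge0 => i _; rewrite mulr_ge0 ?weight_ge0.
Qed.

Section Walk.
Context {d : measure_display} {Omega : measurableType d}
  (P : probability Omega R).
Variable g : nat -> {RV P >-> G}.
Hypothesis g_law : forall i A, distribution P (g i) A = mu A.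
Hypothesis g_indep : mutually_independent g.

Lemma prob_preimage i A : P (g i @^-1` A) = mu A.
Proof. by rewrite -(g_law i). Qed.

Lemma measurable_preimage i A : measurable (g i @^-1` A).
Proof. exact: measurable_funPTI. Qed.

(** Prescribing the cells [ks] of the first increments, then one more, cuts the
event along the recursion that defines words; the second condition restricts the
walk to the truncation throughout. *)
Definition itinerary n K (ks : seq nat) : set Omega :=
  [set w | (forall j, (j < size ks)%N -> cell (nth 0%N ks j) (g j w)) /\
    forall j, (j < n)%N -> exists2 i, (i < K)%N & cell i (g j w)].

Lemma itineraryE n K ks : itinerary n K ks =
  (\bigcap_(j in `I_(size ks)) (g j @^-1` cell (nth 0%N ks j))) `&`
  (\bigcap_(j in `I_n) (g j @^-1` (\bigcup_(i in `I_K) cell i))).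
Proof. by apply/seteqP; split. Qed.

Lemma measurable_itinerary n K ks : measurable (itinerary n K ks).
Proof.
rewrite itineraryE; apply: measurableI; apply: bigcap_measurableType => j _;
  exact: measurable_preimage.
Qed.

Lemma itinerary_split n K ks : (size ks < n)%N ->
  itinerary n K ks = \big[setU/set0]_(i < K) itinerary n K (rcons ks i).
Proof.
move=> ksn; rewrite -(bigcup_mkord K (fun i => itinerary n K (rcons ks i)));
  apply/seteqP; split=> w.
  move=> [H1 H2]; have [i iK Hi] := H2 _ ksn; exists i => //; split=> // j.
  rewrite size_rcons ltnS nth_rcons leq_eqVlt => /orP[/eqP ->|jk].
    by rewrite ltnn eqxx.
  by rewrite jk; exact: H1.
move=> [i iK [H1 H2]]; split=> // j jk; have := H1 j.
by rewrite size_rcons nth_rcons jk; apply; exact: ltnW.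
Qed.

Lemma itinerary_trivIset n K ks : trivIset setT
  (fun i => itinerary n K (rcons ks i)).
Proof.
move=> i j _ _ [w [[H1 _] [H2 _]]].
have := H1 (size ks); have := H2 (size ks).
rewrite !size_rcons !nth_rcons ltnn eqxx => /(_ (ltnSn _))[_ <-]
  /(_ (ltnSn _))[_ <-].
by [].
Qed.

Lemma prob_itinerary_le n K ks : size ks = n ->
  (P (itinerary n K ks) <= (\prod_(i <- ks) weight i)%:E)%E.
Proof.
move=> ksn; pose J := [fset j in iota 0 n]%fset.
have JE : perm_eq J (iota 0 n).
  apply: uniq_perm; rewrite ?fset_uniq ?iota_uniq // => j.
  by rewrite !inE.
have := g_indep J (fun j => measurable_isometries (cell (nth 0%N ks j))).
move=> H; apply: (@le_trans _ _ (P (\bigcap_(j in [set` J])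
  (g j @^-1` cell (nth 0%N ks j))))).
  apply: le_measure; rewrite ?inE.
  - exact: measurable_itinerary.
  - by apply: bigcap_measurableType => j _; exact: measurable_preimage.
  - move=> w [H1 _] j /=; rewrite (perm_mem JE) mem_iota /= add0n => jn.
    by apply: H1; rewrite ksn.
rewrite H (perm_big _ JE) /=.
under eq_bigr do rewrite prob_preimage -weightE.
rewrite prodEFin lee_fin -[in leRHS](mkseq_nth 0%N ks) /mkseq ksn big_map.
by [].
Qed.

Lemma itinerary_walk n K ks w : size ks = n -> itinerary n K ks w ->
  walk g n w = prodw (map cell_elt ks).
Proof.
move=> ksn [H _].
have E (v : seq G) : (\prod_(s <- v) s)%g = prodw v.
  by elim: v => [|s v IH]; rewrite ?big_nil ?big_cons ?IH.
rewrite -E big_map /walk -[in RHS](mkseq_nth 0%N ks) /mkseq ksn big_map.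
have -> : iota 0 n = index_iota 0 n by rewrite /index_iota subn0.
rewrite big_mkord; apply: eq_bigr => j _.
by apply: cell_eltP; apply: H; rewrite ksn.
Qed.

(** Finite subadditivity suffices to sum over itineraries. So the lemma applies
to the outer measure restricted to an event, which need not be measurable, as
well as to an integral. *)
Lemma itinerary_ind (nu : set Omega -> \bar R) n K (f : G -> R) :
  (forall F : nat -> set Omega, (forall i, measurable (F i)) -> trivIset setT F
    ->
    (nu (\big[setU/set0]_(i < K) F i) <= \sum_(i < K) nu (F i))%E) ->
  (forall ks, size ks = n -> (nu (itinerary n K ks) <=
    (\prod_(i <- ks) weight i * f (prodw (map cell_elt ks)))%:E)%E) ->
  (nu (itinerary n K [::]) <= (ev (pow_law (atom_law K) n) f)%:E)%E.
Proof.
move=> nuU base; rewrite ev_pow.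
suff H m ks : (size ks + m = n)%N -> (nu (itinerary n K ks) <=
    (\prod_(i <- ks) weight i * ev (words (atom_law K) m)
      (fun w => f (prodw (map cell_elt ks ++ w))))%:E)%E.
  by have := H n [::] (add0n n); rewrite big_nil mul1r.
elim: m ks => [|m IH] ks.
  by rewrite addn0 => ksn; rewrite ev_words0 cats0; exact: base.
move=> ksm; rewrite itinerary_split; last by rewrite -ksm -addSnnS leq_addr.
have := nuU (fun i => itinerary n K (rcons ks i))
  (fun i => measurable_itinerary n K (rcons ks i)) (@itinerary_trivIset n K ks).
move=> /le_trans; apply.
rewrite ev_wordsS ev_atom_law mulr_sumr -sumEFin; apply: lee_sum => i _.
have := IH (rcons ks i); rewrite size_rcons addSnnS => /(_ ksm)/le_trans; apply.
rewrite lee_fin -cats1 big_cat big_seq1 -mulrA /= map_cat.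
by under eq_ev do rewrite -catA.
Qed.

Lemma prob_bad_le n K :
  (P (~` itinerary n K [::]) <= (n%:R * (1 - ev (atom_law K) (fun=> 1)))%:E)%E.
Proof.
pose S := \bigcup_(i in `I_K) cell i.
have muS : mu (~` S) = (1 - ev (atom_law K) (fun=> 1))%:E.
  rewrite probability_setC // EFinB atom_law_mass; congr (_ - mu _)%E.
  exact: (bigcup_mkord K cell).
have sub : ~` itinerary n K [::] `<=` \big[setU/set0]_(j < n)
  (g j @^-1` (~` S)).
  move=> w; rewrite itineraryE /= => H; apply: contrapT => H'; apply: H; split.
    by move=> j.
  move=> j /= jn; apply: contrapT => H''; apply: H'.
  by rewrite -(bigcup_mkord n (fun j => g j @^-1` (~` S))); exists j.
apply: (@le_trans _ _ (P (\big[setU/set0]_(j < n) (g j @^-1` (~` S))))).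
  apply: le_measure; rewrite ?inE //.
    by apply: measurableC; exact: measurable_itinerary.
  by apply: bigsetU_measurable => j _; exact: measurable_preimage.
have := @Boole_inequality _ _ _ P (fun j => g j @^-1` (~` S)) n
  (fun j _ => measurable_preimage j (~` S)).
move=> /le_trans; apply.
apply: (@le_trans _ _ (\sum_(j < n) mu (~` S))%E).
  by apply: lee_sum => j _; rewrite -(prob_preimage j).
by rewrite (eq_bigr _ (fun _ _ => muS)) sumEFin sumr_const card_ord mulr_natl.
Qed.

End Walk.
End Atoms.

Section Bridge.
Context {R : realType} {X : metricType R} (o : X).
Local Notation G := (bij_isometry X).
Local Notation len := (len o).
Variable mu : probability G R.
Variable C : set G.
Hypothesis mu_C : mu (~` C) = 0%E.
Variable code : G -> nat.
Hypothesis code_inj : {in C &, injective code}.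
Context {d : measure_display} {Omega : measurableType d}
  (P : probability Omega R).
Variable g : nat -> {RV P >-> G}.
Hypothesis g_law : forall i A, distribution P (g i) A = mu A.
Hypothesis g_indep : mutually_independent g.

Local Notation atom_law := (atom_law mu C code).
Local Notation weight := (weight mu C code).
Local Notation cell_elt := (cell_elt C code).
Local Notation itinerary := (itinerary C code g).

Let Hth : exhausting atom_law.
Proof. exact: exhausting_atom_law. Qed.

Let Hpow K n : sublaw (pow_law (atom_law K) n).
Proof. by case: Hth => H _ _; exact: sublaw_pow. Qed.

Lemma bad_small n (e : R) : 0 < e ->
  exists K, (P (~` itinerary n K [::]) <= e%:E)%E.
Proof.
move=> e0; case: Hth => _ _ /(_ (e / n.+1%:R))[|K HK];
  first by rewrite divr_gt0.
exists K; apply: (le_trans (prob_bad_le C code g_law n K)).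
rewrite lee_fin; apply: (@le_trans _ _ (n%:R * (e / n.+1%:R))).
  by rewrite ler_wpM2l // lerBlDr -lerBlDl.
by rewrite mulrCA ler_piMr ?(ltW e0) // ler_pdivrMr // mul1r ler_nat.
Qed.

(** The walk leaves the truncation with a probability that tends to 0, and
inside the truncation the event is a finite union of itineraries. *)
Lemma outer_prob_le n (rho x : R) :
  (forall K, ev (pow_law (atom_law K) n) (fun s => (len s <= rho)%R%:R) <= x) ->
  ((P^*)%mu [set w | mdist o (walk g n w o) <= rho]%R <= x%:E)%E.
Proof.
move=> Hx; set A := [set w | _]; apply/lee_addgt0Pr => e e0.
have [K HK] := bad_small n e0.
set I := itinerary n K [::] in HK.
apply: (@le_trans _ _ ((P^*)%mu (A `&` I) + (P^*)%mu (A `&` ~` I))%E).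
  exact: le_outer_measureIC.
apply: leeD; last first.
  apply: le_trans HK; rewrite -measurable_mu_extE; last first.
    by apply: measurableC; exact: measurable_itinerary.
  by apply: le_mu_ext => w [].
rewrite setIC.
apply: le_trans (_ : ((ev (pow_law (atom_law K) n)
  (fun s => (len s <= rho)%R%:R))%:E <= _)%E); last by rewrite lee_fin.
apply: (itinerary_ind (nu := fun S => (P^*)%mu (S `&` A))).
  move=> F mF tF.
  apply: le_trans (outer_measure_subadditive _ (fun i => F i `&` A) K).
  apply: le_mu_ext => w; rewrite -(bigcup_mkord K F)
    -(bigcup_mkord K (fun i => F i `&` A)).
  by move=> [[i iK Fi] Aw]; exists i.
move=> ks ksn; case: (leP (len (prodw (map cell_elt ks))) rho) => H.
  rewrite mulr1; apply: le_trans (prob_itinerary_le C code g_law g_indep K ksn).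
  rewrite -measurable_mu_extE; last exact: measurable_itinerary.
  by apply: le_mu_ext => w [].
rewrite mulr0 (_ : _ `&` A = set0) ?outer_measure0 //.
apply/seteqP; split=> // w [Iw]; rewrite /A /=.
by rewrite (itinerary_walk code_inj ksn Iw) leNgt; move: H; rewrite /len => ->.
Qed.

Import HBNNSimple.

(** The expectation is approached by simple functions. Being bounded, they have
a small integral over the event that the walk leaves the truncation. *)
Lemma drift_of_expectation n (x : R) :
  (x%:E < 'E_P[fun w => mdist o (walk g n w o)])%E ->
  exists K, x <= ev (pow_law (atom_law K) n) len.
Proof.
rewrite unlock ge0_integralTE => [|w]; last by rewrite lee_fin mdist_ge0.
move=> /ereal_sup_gt[_ [h /= hle <-]]; rewrite -integralT_nnsfun => xh.
apply: contrapT => /forallNP none.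
have {}none K : ev (pow_law (atom_law K) n) len <= x.
  by apply: ltW; rewrite ltNge; apply/negP; exact: none.
suff : (\int[P]_w (h w)%:E <= x%:E)%E by rewrite leNgt xh.
have h0 w : (0 <= (h w)%:E)%E by rewrite lee_fin fun_ge0.
have mh (D : set Omega) : measurable_fun D (fun w => (h w)%:E).
  by apply/measurable_EFinP; exact: measurable_funP.
have [B B0 HB] : exists2 B, 0 < B & forall w, h w <= B.
  have [M [_ HM]] := simple_bounded h.
  exists (`|M| + 1) => [|w]; first by rewrite ltr_wpDl.
  apply: le_trans (ler_norm _) _; apply: HM => //.
  by rewrite ltr_pwDr // ler_norm.
apply/lee_addgt0Pr => e e0.
have [K HK] := bad_small n (divr_gt0 e0 B0).
set I := itinerary n K [::] in HK.
have mI : measurable I by exact: measurable_itinerary.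
have mIC : measurable (~` I) by exact: measurableC.
rewrite -(setUv I) ge0_integral_setU //; last by apply/disj_setPS;
  rewrite setICr.
apply: leeD; last first.
  apply: (@le_trans _ _ (\int[P]_(w in ~` I) B%:E)%E).
    by apply: ge0_le_integral => // w _; rewrite lee_fin // ltW.
  rewrite integral_cst //.
  apply: (@le_trans _ _ (B%:E * (e / B)%:E)%E);
    first by rewrite lee_wpmul2l // lee_fin ltW.
  by rewrite -EFinM mulrC divfK // gt_eqF.
apply: (@le_trans _ _ (ev (pow_law (atom_law K) n) len)%:E);
  last by rewrite lee_fin.
apply: (itinerary_ind (nu := fun S => (\int[P]_(w in S) (h w)%:E)%E)).
  move=> F mF tF.
  rewrite -(big_mkord xpredT F) -(big_mkord xpredT
    (fun i => (\int[P]_(w in F i) (h w)%:E)%E)).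
  rewrite ge0_integral_bigsetU ?iota_uniq //.
  exact: sub_trivIset tF.
move=> ks ksn; set c := len _.
have mIk : measurable (itinerary n K ks) by exact: measurable_itinerary.
apply: (@le_trans _ _ (\int[P]_(w in itinerary n K ks) c%:E)%E).
  apply: ge0_le_integral => // w Iw.
  by apply: (le_trans (hle w)); rewrite lee_fin
    (itinerary_walk code_inj ksn Iw).
rewrite integral_cst // muleC EFinM lee_wpmul2r ?lee_fin ?len_ge0 //.
exact: prob_itinerary_le.
Qed.

End Bridge.

Section InfiniteMean.
Context {R : realType} {X : metricType R} (o : X).
Local Notation G := (bij_isometry X).
Local Notation len := (len o).

(** With mass at least [1 / 2] the letters after the first belong to a fixed
truncation, where they move [o] by [c] in mean; the mean length of the first
letter is unbounded. *)
Lemma drift_of_infinite_mean (th : nat -> seq (R * G)) (r : R) : exhausting th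
  ->
  (forall B, exists K, B <= ev (th K) len) -> drift o th r.
Proof.
move=> Hth unb m0; exists m0.+1 => //.
have Hsub K : sublaw (th K) by case: Hth.
have Hpow K n : sublaw (pow_law (th K) n) by exact: sublaw_pow.
have half : 0 < 2^-1 :> R by rewrite invr_gt0.
have [K1 HK1] := words_mass Hth m0 half.
pose c := ev (pow_law (th K1) m0) len.
have c0 : 0 <= c by apply: ev_ge0 => // s; exact: len_ge0.
have [K2 HK2] := unb (2 * (r * m0.+1%:R + c)).
have [_ mono _] := Hth.
exists (maxn K1 K2); set K := maxn K1 K2.
rewrite -add1n ev_powD ev_pow ev_words1.
apply: (@le_trans _ _ (ev (th K) (fun s => 2^-1 * len s - c))); last first.
  apply: ev_le => // s; rewrite /= mulg1.
  apply: le_trans (ev_pow_mono Hth m0 (leq_maxl K1 K2)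
    (fun t => len_ge0 o (s * t)%g)).
  apply: (@le_trans _ _ (ev (pow_law (th K1) m0) (fun t => len s - len t))).
    rewrite evB -/c ev_cst lerD2r mulrC ler_wpM2l ?len_ge0 //.
    by rewrite ev_pow; lra.
  apply: ev_le => // t; have := lenM_le o (s * t)%g (isometry_inv t).
  by rewrite -mulgA inv_mulV mulg1 len_inv; lra.
rewrite evB evZ ev_cst.
have : c * ev (th K) (fun=> 1) <= c by rewrite ler_piMr //; case: (Hsub K).
have := mono K2 K len (leq_maxr _ _) (len_ge0 o).
lra.
Qed.

Variable mu : probability G R.
Variable C : set G.
Hypothesis mu_C : mu (~` C) = 0%E.
Variable code : G -> nat.
Hypothesis code_inj : {in C &, injective code}.
Local Notation cell := (cell C code).
Local Notation atom_law := (atom_law mu C code).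

Lemma mean_length_unbounded : moment1 mu o = +oo%E ->
  forall B, exists K, B <= ev (atom_law K) len.
Proof.
move=> inf B; apply: contrapT => /forallNP none.
have {}none K : ev (atom_law K) len <= B.
  by apply: ltW; rewrite ltNge; apply/negP; exact: none.
suff : (moment1 mu o <= B%:E)%E by rewrite inf leye_eq.
pose I := [set i | cell i !=set0].
have cellE i : I i -> cell i = [set cell_elt C code i].
  move=> [h Hh]; apply/seteqP; split=> [k Hk|_ ->]; first exact: cell_eltP.
  by rewrite -(cell_eltP code_inj Hh).
have CE : C = cell_elt C code @` I.
  apply/seteqP; split=> [h Ch|_ [i Ii <-]].
    have Hh : cell (code h) h by [].
    by exists (code h); [exists h|rewrite -(cell_eltP code_inj Hh)].
  by have [] : cell i (cell_elt C code i) by rewrite cellE.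
have Iinj : set_inj I (cell_elt C code).
  move=> i j; rewrite !inE => Ii Ij E.
  have [_ Hi] : cell i (cell_elt C code i) by rewrite cellE.
  have [_ Hj] : cell j (cell_elt C code j) by rewrite cellE.
  by rewrite -Hi E Hj.
pose a h := (mu [set h] * (mdist o (h o))%:E)%E.
have a0 h : (0 <= a h)%E by rewrite mule_ge0 // lee_fin mdist_ge0.
have -> : moment1 mu o = (\esum_(h in C) a h)%E.
  rewrite /moment1 [RHS]esum_mkcond; apply: eq_esum => h _.
  case: ifPn => //; rewrite notin_setE => nCh.
  have -> : mu [set h] = 0%E.
    apply/eqP; rewrite eq_le measure_ge0 andbT -mu_C.
    by apply: le_measure; rewrite ?inE // => _ ->.
  by rewrite mul0e.
rewrite [X in esum X]CE esum_set_image //.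
apply: lime_le; first exact: is_cvg_nneseries.
near=> K; apply: le_trans (_ : ((ev (atom_law K) len)%:E <= _)%E);
  last by rewrite lee_fin.
rewrite ev_atom_law big_mkcond big_mkord -sumEFin; apply: lee_sum => i _.
case: ifPn => [|_]; last by rewrite lee_fin mulr_ge0 ?weight_ge0 ?len_ge0.
by rewrite inE => Ii; rewrite /a -!/(cell_elt C code i) EFinM weightE
  (cellE i Ii).
Unshelve. all: by end_near. Qed.

End InfiniteMean.

Unset Implicit Arguments.

(* When some g_i leaves the countable support of mu on a P-null set, the event
   below need not belong to the sigma-algebra of Omega, whence the outer
   measure of P, which agrees with P on measurable sets. *)
Theorem theorem1p2 (R : realType) (X : metricType R) (o : X)
    (mu : probability (bij_isometry X) R)
    (d : measure_display) (Omega : measurableType d) (P : probability Omega R)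
    (g : nat -> {RV P >-> bij_isometry X}) (r : R) :
  gromov_hyperbolic X ->
  discrete_probability mu ->
  non_elementary mu o ->
  (forall i A, distribution P (g i) A = mu A) ->
  mutually_independent g ->
  (r%:E < escape_rate g mu o)%E ->
  exists2 kappa : R, 0 < kappa &
    forall n : nat,
      ((P^*)%mu [set w | mdist o (walk g n w o) <= r * n%:R]%R
        <= (expR (- kappa * n%:R))%:E)%E.
Proof.
move=> [delta delta0 hyp] [C Ccount mu_C] [f [h [Sf Sh lf lh disj]]] g_law
  g_indep rl.
have [code code_inj] := countable_injP _ Ccount.
pose th := atom_law mu C code.
have Hth : exhausting th by exact: exhausting_atom_law.
have [sch sch_inv] := non_elementary_schottky delta0 hyp Hth
  (charged_atom mu_C code_inj) Sf Sh lf lh disj.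
(* If [r < 0] then the event is empty for [n > 0]. *)
have [r_lt0|r0] := ltP r 0.
  exists 1 => // -[|n].
    rewrite !mulr0 expR0; apply: (@le_trans _ _ (P setT));
      last by rewrite probability_setT.
    by rewrite -measurable_mu_extE //; exact: le_mu_ext.
  rewrite (_ : [set w | _] = set0) ?outer_measure0 ?lee_fin ?expR_ge0 //.
  apply/seteqP; split=> // w /=; rewrite leNgt => /negP; apply.
  by rewrite (lt_le_trans _ (mdist_ge0 _ _)) // nmulr_rlt0.
suff [r' rr' dr] : exists2 r', r < r' & drift o th r'.
  have [kap kap0 Hkap] := sharp_exponential_bound delta0 hyp Hth sch sch_inv r0
    rr' dr.
  exists kap => // n.
  exact: (outer_prob_le mu_C code_inj g_law g_indep (fun K => Hkap K n)).
move: rl; rewrite /escape_rate; case: ifPn => [_|]; last first.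
  rewrite ltNge negbK leye_eq => /eqP inf _; exists (r + 1);
    first by rewrite ltrDl.
  by apply: drift_of_infinite_mean => //; exact: mean_length_unbounded.
set u := fun n : nat => _; move=> rl.
have [r' rr' r'l] : exists2 r', r < r' & (r'%:E < limn u)%E.
  case: (limn u) rl => [l|_|//]; last by exists (r + 1); rewrite ?ltrDl // ltry.
  rewrite lte_fin => rl; exists ((r + l) / 2); first by lra.
  by rewrite lte_fin; lra.
(* The limit of a divergent sequence is 0 by convention, and [0 <= r]. *)
have cu : cvgn u.
  apply: contrapT => ncu; have u0 : limn u = 0%E := dvgP ncu.
  by move: rl; rewrite u0 ltNge lee_fin r0.
exists r' => // m0; apply: contrapT => /forall2NP none.
suff : (limn u <= r'%:E)%E by rewrite leNgt r'l.
apply: lime_le => //; exists (maxn m0 1) => // m /=;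
  rewrite geq_max => /andP[mm m1].
have mR : 0 < m%:R :> R by rewrite ltr0n.
rewrite /u leNgt; apply/negP => H.
have [//|/forallNP Hm] := none m.
have [|K HK] := @drift_of_expectation _ _ o mu C mu_C code code_inj _ _ P g
  g_law g_indep m (r' * m%:R).
  move: H; rewrite ltNge; case: ('E_P[_])%E => [e||] //; rewrite -?EFinM.
  - by rewrite -ltNge !lte_fin ltr_pdivlMr.
  - by rewrite ltry.
  - by rewrite gt0_mulNye ?lte_fin ?invr_gt0 // leNye.
by apply: (Hm K).
Qed.
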